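(* Let $\mathcal{F}\subseteq\mathcal{F}_{\mathrm{an}}$ be a set of convergent power series representing restricted analytic functions, closed under partial derivatives and containing the restricted exponential and restricted logarithm. Take any $\mathcal{L}_{\mathcal F}$-embedding of $LE_{\mathcal F}(x)$ in some generalized power series field $\mathbb{R}((G))$, and denote by $L$ its image in $\mathbb{R}((G))$. Assume that the restriction of the canonical cross-section of $\mathbb{R}((G))$ to $vL$ is a cross-section $\pi$ of $(L,v)$, and that $L=\mathbb{R}(\pi vL)^{\mathrm{r}\mathcal F}$. Then the nonzero elements of the support of each element in $L$ are bounded away from $0$.
   Context: $\mathcal{F}_{\mathrm{an}}$ is the family of restricted analytic functions, i.e. functions $\mathbb{R}^n\to\mathbb{R}$ given on $[-1,1]^n$ by a real power series converging on a neighbourhood of $[-1,1]^n$ and equal to $0$ outside $[-1,1]^n$; the restricted exponential and logarithm are the restrictions of $\exp$ and $\log$ to compact intervals (a neighbourhood of $1$ for $\log$), regarded as restricted analytic functions. $T_{\mathrm{an}}(\exp)$ is the theory of the ordered field of reals with all functions in $\mathcal{F}_{\mathrm{an}}$ and the unrestricted exponential. Let $M$ be a non-archimedean model of $T_{\mathrm{an}}(\exp)$ containing $(\mathbb{R},+,\cdot,<,\mathcal{F},\exp)$ as a substructure and let $x\in M$ be positive and infinitely large. $LE_{\mathcal F}(x)$ is the closure in $M$ of $\mathbb{R}(x)$ under real closure, $\mathcal{F}$, $\exp$ and its inverse $\log$ (on positive elements). $\mathcal{L}_{\mathcal F}$ is the language of ordered rings enriched by symbols for the functions from $\mathcal{F}$.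 For an ordered abelian group $G$, $\mathbb{R}((G))$ is the field of formal series with real coefficients, exponents in $G$ and well-ordered support, ordered by the sign of the leading coefficient, with natural valuation $v$ sending a nonzero series to the minimum of its support; the functions in $\mathcal{F}$ are interpreted on it by Taylor expansion (for a tuple $a+\varepsilon\in[-1,1]^n$ with $a$ real and $\varepsilon$ infinitesimal, $f(a+\varepsilon)$ is the Taylor series of $f$ at $a$ evaluated at $\varepsilon$) and by $0$ outside $[-1,1]^n$. $\mathbb{R}$ is regarded as the field of constants of $\mathbb{R}((G))$. The canonical cross-section sends $\alpha\in G$ to the element $1_\alpha\in\mathbb{R}((G))$ with coefficient $1$ at $\alpha$ and zeros elsewhere. A cross-section of a valued field $(L,v)$ is an embedding $\iota:vL\to L^\times$ of the value group with $v\iota(\alpha)=\alpha$ for all $\alpha$. $\mathbb{R}(\pi vL)^{\mathrm{r}\mathcal F}$ is the smallest subfield of $\mathbb{R}((G))$ containing $\mathbb{R}$ and the image of $\pi$ which is closed under the functions in $\mathcal{F}$, henselian with respect to $v$ and real closed. A set of nonzero elements $S\subseteq G$ is bounded away from $0$ if there are $\beta<0<\gamma$ in $G$ such that no element of $S$ lies strictly between $\beta$ and $\gamma$. *)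

(* Defs.v *)
From HB Require Import structures.
From mathcomp Require Import all_boot all_order all_algebra finmap.
From mathcomp Require Import mathcomp_extra boolp classical_sets functions.
From mathcomp Require Import cardinality fsbigop reals ereal topology.
From mathcomp Require Import normedtype sequences numfun esum exp.

Set Implicit Arguments.
Unset Strict Implicit.
Unset Printing Implicit Defensive.
Import Order.TTheory GRing.Theory Num.Theory.
Local Open Scope classical_set_scope.
Local Open Scope ring_scope.

HB.mixin Record isOrderedAbelianGroup G of Num.POrderedZmodule G := {
  oz_le_total : forall a b : G, (a <= b) || (b <= a);
  oz_leD2r : forall c a b : G, a <= b -> a + c <= b + c
}.

#[short(type="orderedAbelianGroupType")]
HB.structure Definition OrderedAbelianGroup :=
  { G of Num.POrderedZmodule G & isOrderedAbelianGroup G }.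

Section OrderedZmoduleTheory.
Variable G : orderedAbelianGroupType.
Implicit Types a b c d : G.

Lemma oz_ltNge a b : (a < b) = ~~ (b <= a).
Proof.
apply/idP/idP => [ab|]; first by apply/negP => /(lt_le_trans ab); rewrite ltxx.
move=> nba; rewrite lt_neqAle; apply/andP; split.
  by apply: contraNneq nba => ->.
by have := oz_le_total a b; rewrite (negPf nba) orbF.
Qed.

Lemma oz_leNgt a b : (a <= b) = ~~ (b < a).
Proof. by rewrite oz_ltNge negbK. Qed.

Lemma oz_leD2 c a b : (a + c <= b + c) = (a <= b).
Proof.
by apply/idP/idP => [/(oz_leD2r (- c))|/oz_leD2r->//]; rewrite !addrK.
Qed.

Lemma oz_ltD2 c a b : (a + c < b + c) = (a < b).
Proof. by rewrite !oz_ltNge oz_leD2. Qed.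

Lemma oz_leD a b c d : a <= b -> c <= d -> a + c <= b + d.
Proof.
move=> ab cd; apply: (@le_trans _ _ (b + c)); first by rewrite oz_leD2.
by rewrite addrC (addrC b) oz_leD2.
Qed.

Lemma oz_ltleD a b c d : a < b -> c <= d -> a + c < b + d.
Proof.
move=> ab cd; apply: (@lt_le_trans _ _ (b + c)); first by rewrite oz_ltD2.
by rewrite addrC (addrC b) oz_leD2.
Qed.

Lemma oz_subgt0 a b : (0 < b - a) = (a < b).
Proof. by rewrite -[LHS](oz_ltD2 a) add0r subrK. Qed.

End OrderedZmoduleTheory.

Section WellOrdered.
Variable G : orderedAbelianGroupType.
Implicit Types (A B : set G) (a b c : G).

Definition well_ordered A :=
  forall B, B `<=` A -> B !=set0 -> exists2 m, B m & forall b, B b -> m <= b.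

Lemma wo_sub A B : A `<=` B -> well_ordered B -> well_ordered A.
Proof. by move=> AB wB C CA; apply: wB => x /CA/AB. Qed.

Lemma iter_ltn (f : nat -> nat) :
  (forall k, (f k < f k.+1)%N) -> forall i j, (i < j)%N -> (f i < f j)%N.
Proof.
move=> fS i; elim=> // j IH; rewrite ltnS leq_eqVlt => /orP[/eqP->//|/IH h].
exact: ltn_trans h (fS j).
Qed.

Lemma wo_subseq A (u : nat -> G) : well_ordered A -> (forall k, A (u k)) ->
  exists phi : nat -> nat, (forall i j, (i < j)%N -> (phi i < phi j)%N) /\
    forall i j, (i <= j)%N -> u (phi i) <= u (phi j).
Proof.
move=> wA uA.
have nxP k : exists j, (k < j)%N /\ forall i, (k < i)%N -> u j <= u i.
  have [_ [j kj <-] jmin] := wA [set u j | j in [set j | (k < j)%N]]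
    (fun x '(ex_intro2 j _ e) => let: erefl := e in uA j)
    (ex_intro _ _ (ex_intro2 _ _ k.+1 (ltnSn k) erefl)).
  by exists j; split => // i ki; apply: jmin; exists i.
have [nx nxE] := choice nxP.
pose phi k := iter k nx (nx 0%N).
have phiS k : (phi k < phi k.+1)%N by rewrite /phi iterS; exact: (nxE _).1.
exists phi; split; first exact: iter_ltn.
suff S k : u (phi k) <= u (phi k.+1).
  move=> i; elim=> [|j IH]; first by rewrite leqn0 => /eqP->.
  by rewrite leq_eqVlt => /orP[/eqP->//|/IH/le_trans]; apply.
have [m mE] : exists m, phi k = nx m.
  by case: k => [|k]; [exists 0%N|exists (phi k)].
rewrite mE; apply: (nxE m).2; apply: (ltn_trans _ (phiS k)).
by rewrite mE; exact: (nxE m).1.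
Qed.

Lemma wo_seqP A :
  (forall u : nat -> G, (forall k, A (u k)) ->
    exists i j, (i < j)%N /\ u i <= u j) -> well_ordered A.
Proof.
move=> H B BA [b0 Bb0]; apply: contrapT => nomin.
have nxP (b : {b | B b}) : exists b' : {b | B b}, sval b' < sval b.
  apply: contrapT => nb; apply: nomin; exists (sval b); first exact: (svalP b).
  move=> c Bc; rewrite oz_leNgt; apply/negP => cb; apply: nb.
  by exists (exist _ c Bc).
have [nx nxE] := choice nxP.
pose u k := iter k nx (exist _ b0 Bb0).
have ulast i j : (i < j)%N -> sval (u j) < sval (u i).
  elim: j => // j IH; rewrite ltnS leq_eqVlt => /orP[/eqP->|/IH h].
    exact: nxE.
  exact: lt_trans (nxE _) h.
have [|i [j [ij]]] := H (fun k => sval (u k)).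
  by move=> k; apply/BA/(svalP (u k)).
by rewrite oz_leNgt ulast.
Qed.

Lemma wo_infinite A : ~ finite_set A ->
  exists u : nat -> G, (forall k, A (u k)) /\ injective u.
Proof.
move=> Ainf.
have pickP (s : seq G) : exists a, A a /\ a \notin s.
  apply: contrapT => H; apply: Ainf; apply: (@sub_finite_set _ _ [set` s]).
    by move=> a Aa; apply: contrapT => /negP as_; apply: H; exists a.
  exact: finite_seq.
have [pick pE] := choice pickP.
pose U k := iter k (fun s => pick s :: s) [::].
have UU i j : (i < j)%N -> pick (U i) \in U j.
  elim: j => // j IH; rewrite ltnS leq_eqVlt inE => /orP[/eqP->|/IH->].
    by rewrite eqxx.
  by rewrite orbT.
exists (fun k => pick (U k)); split=> [k|i j e]; first exact: (pE _).1.
case: (ltngtP i j) => // /UU; first by rewrite e (negPf (pE _).2).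
by rewrite -e (negPf (pE _).2).
Qed.

Definition sumset A B := [set c | exists a b, [/\ A a, B b & c = a + b]].

Lemma wo_sumset A B : well_ordered A -> well_ordered B ->
  well_ordered (sumset A B).
Proof.
move=> wA wB; apply: wo_seqP => u uS.
have [a aP] := choice uS.
have [b bP] := choice aP.
have [phi [phiS phim]] : exists phi : nat -> nat,
   (forall i j, (i < j)%N -> (phi i < phi j)%N) /\
    forall i j, (i <= j)%N -> a (phi i) <= a (phi j).
  by apply: (wo_subseq wA) => k; case: (bP k).
have [psi [psiS psim]] : exists phi' : nat -> nat,
   (forall i j, (i < j)%N -> (phi' i < phi' j)%N) /\
    forall i j, (i <= j)%N -> b (phi (phi' i)) <= b (phi (phi' j)).
  by apply: (wo_subseq (u := b \o phi) wB) => k; case: (bP (phi k)).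
exists (phi (psi 0)), (phi (psi 1)); split; first exact/phiS/psiS.
case: (bP (phi (psi 0))) => _ _ ->; case: (bP (phi (psi 1))) => _ _ ->.
by apply: oz_leD; [apply/phim/ltnW/psiS|exact/psim].
Qed.

Lemma wo_fiber A B c : well_ordered A -> well_ordered B ->
  finite_set [set a | A a /\ B (c - a)].
Proof.
move=> wA wB; apply: contrapT => /wo_infinite[u [uP uinj]].
have [phi [phiS phim]] := wo_subseq wA (fun k => (uP k).1).
have [psi [psiS psim]] :=
  wo_subseq (u := fun k => c - u (phi k)) wB (fun k => (uP _).2).
have /= := psim 0%N 1%N isT.
have p01 : (psi 0 < psi 1)%N by exact: psiS.
have lt01 : u (phi (psi 0)) < u (phi (psi 1)).
  rewrite lt_neqAle phim ?(ltnW p01)// andbT; apply/eqP => /uinj e.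
  by have := phiS _ _ p01; rewrite e ltnn.
rewrite oz_leNgt => /negP; apply.
rewrite -oz_subgt0 opprD opprK addrACA subrr add0r addrC.
by rewrite oz_subgt0.
Qed.

Lemma wo_setU A B : well_ordered A -> well_ordered B -> well_ordered (A `|` B).
Proof.
move=> wA wB C CAB [c Cc].
have [[a Ca]|nA] := pselect (C `&` A !=set0); last first.
  apply: wB; last by exists c.
  by move=> x Cx; case: (CAB _ Cx) => // Ax; case: nA; exists x.
have [[b Cb]|nB] := pselect (C `&` B !=set0); last first.
  apply: wA; last by exists c.
  by move=> x Cx; case: (CAB _ Cx) => // Ax; case: nB; exists x.
have [m1 [Cm1 Am1] m1P] := wA _ (@subIsetr _ C A) (ex_intro _ _ Ca).
have [m2 [Cm2 Bm2] m2P] := wB _ (@subIsetr _ C B) (ex_intro _ _ Cb).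
case/orP: (oz_le_total m1 m2) => m12; [exists m1|exists m2] => // x Cx;
  case: (CAB _ Cx) => Ax; [exact: m1P| |  |exact: m2P].
  by apply: (le_trans m12); apply: m2P.
by apply: (le_trans m12); apply: m1P.
Qed.

Lemma wo_set1 a : well_ordered [set a].
Proof. by move=> B Ba [b Bb]; exists b => // c /Ba->; rewrite (Ba _ Bb). Qed.

Lemma wo_set0 : well_ordered set0.
Proof. by move=> B B0 [b /B0]. Qed.

Lemma wo_bigcup (n : nat) (F : 'I_n -> set G) :
  (forall i, well_ordered (F i)) -> well_ordered (\bigcup_i F i).
Proof.
elim: n F => [|n IH] F wF; first by apply: wo_sub wo_set0 => x [[]].
apply: (@wo_sub _ (F ord0 `|` \bigcup_i F (lift ord0 i))); last first.
  exact/wo_setU/IH.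
move=> x [i _ Fx]; case: (unliftP ord0 i) Fx => [j|] -> Fx; last by left.
by right; exists j.
Qed.

End WellOrdered.

Arguments wo_sub {G A B} _ _ : rename.
Arguments wo_seqP {G A} _ : rename.
Arguments wo_sumset {G A B} _ _ : rename.
Arguments wo_setU {G A B} _ _ : rename.
Arguments wo_set1 {G} a : rename.
Arguments wo_set0 {G} : rename.
Arguments wo_bigcup {G n F} _ : rename.

(* Neumann's lemma, by a minimal bad sequence argument *)
Section Neumann.
Variables (G : orderedAbelianGroupType) (A : set G).
Hypotheses (wA : well_ordered A) (A0 : forall a, A a -> 0 < a).

Let lists (s : seq G) := forall a, a \in s -> A a.
Let sumg (s : seq G) : G := \sum_(a <- s) a.
Let Q (s t : seq G) := (sumg s < sumg t) || (s == t).

Let sum_ge0 s : lists s -> 0 <= sumg s.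
Proof.
rewrite /sumg; elim: s => [|a s IH] sA; first by rewrite big_nil.
rewrite big_cons -[leLHS]add0r; apply: oz_leD.
  by apply/ltW/A0/sA; rewrite mem_head.
by apply: IH => b bs; apply: sA; rewrite inE bs orbT.
Qed.

Let Qle s t : Q s t -> sumg s <= sumg t.
Proof. by case/orP => [/ltW//|/eqP->]. Qed.

Let bad (u : nat -> seq G) :=
  (forall k, lists (u k)) /\ forall i j, (i < j)%N -> ~~ Q (u i) (u j).

Let agree n (u w : nat -> seq G) := forall i, (i < n)%N -> u i = w i.

Let minbad : (exists u, bad u) -> exists u, bad u /\
  forall n w, bad w -> agree n u w -> (size (u n) <= size (w n))%N.
Proof.
case=> u0 bu0.
(* step n u : a bad sequence agreeing with u below n, of minimal size at n *)
have stepP (p : nat * {u | bad u}) : exists w : {u | bad u},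
    agree p.1 (sval p.2) (sval w) /\
    forall w', bad w' -> agree p.1 (sval p.2) w' ->
      (size (sval w p.1) <= size (w' p.1))%N.
  case: p => n [u bu] /=.
  have ex : exists m, `[< exists w, [/\ bad w, agree n u w & size (w n) = m] >].
    by exists (size (u n)); apply/asboolP; exists u.
  case: (ex_minnP ex) => m /asboolP[w [bw uw <-]] mmin.
  exists (exist _ w bw); split => //= w' bw' uw'.
  by apply: mmin; apply/asboolP; exists w'.
have [step stepE] := choice stepP.
pose fix U n : {u | bad u} :=
  if n is m.+1 then step (m, U m) else exist _ u0 bu0.
have UE n m i : (i < n)%N -> (n <= m)%N -> sval (U n) i = sval (U m) i.
  move=> i_n; elim: m => [|m IH]; first by rewrite leqn0 => /eqP->.
  rewrite leq_eqVlt => /orP[/eqP->//|]; rewrite ltnS => nm.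
  rewrite IH//; apply: (stepE (m, U m)).1 => /=; exact: leq_trans nm.
exists (fun n => sval (U n.+1) n); split.
  split=> [k|i j ij]; first exact: (svalP (U k.+1)).1.
  rewrite (UE i.+1 j.+1) ?ltnS ?(ltnW ij)//.
  exact: (svalP (U j.+1)).2.
move=> n w bw uw; apply: (stepE (n, U n)).2 => //= i i_n.
by rewrite -uw//; apply/esym/UE.
Qed.

Let nobad u : ~ bad u.
Proof.
move=> bu; have [{bu}v [bv vmin]] := minbad (ex_intro _ _ bu).
have [vA vQ] := bv.
have vnil k : v k = head 0 (v k) :: behead (v k).
  case E : (v k) => [|//]; have /negP[] := vQ k k.+1 (ltnSn k).
  rewrite /Q E {1}/sumg big_nil; case E' : (v k.+1) => [|a s].
    by rewrite eqxx orbT.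
  have sA := vA k.+1; rewrite E' in sA.
  apply/orP; left; rewrite /sumg big_cons -[X in X < _]add0r.
  apply: oz_ltleD; first by apply/A0/sA; rewrite mem_head.
  by apply: (@sum_ge0 s) => b bs; apply: sA; rewrite inE bs orbT.
have aA k : A (head 0 (v k)) by apply: (vA k); rewrite [v k]vnil mem_head.
have [phi [phiS phim]] := wo_subseq wA aA.
pose t k := behead (v k).
have sumv k : sumg (v k) = head 0 (v k) + sumg (t k).
  by rewrite {1}(vnil k) /sumg big_cons.
have tA k : lists (t k) by move=> a /mem_behead; exact: vA.
pose w k := if (k < phi 0)%N then v k else t (phi (k - phi 0)%N).
suff bw : bad w.
  have ag : agree (phi 0%N) v w by move=> i i0; rewrite /w i0.
  have := vmin _ _ bw ag; rewrite /w ltnn subnn /t size_behead.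
  by have := vnil (phi 0%N); case: (v (phi 0%N)) => //= a s _; rewrite ltnn.
split=> [k|i j ij]; first by rewrite /w; case: ifP.
rewrite /w; case: ifP => iphi; case: ifP => jphi.
- exact: vQ.
- have iphi' : (i < phi (j - phi 0))%N.
    apply: (leq_trans iphi); case: (j - phi 0)%N => // m; exact/ltnW/phiS.
  apply: contra (vQ _ _ iphi') => /Qle qij; apply/orP; left.
  by rewrite (sumv (phi _)) -[X in X < _]add0r oz_ltleD// A0.
- by move: (ltn_trans ij jphi); rewrite iphi.
have lt' : (phi (i - phi 0) < phi (j - phi 0))%N.
  have i0 : (phi 0 <= i)%N by rewrite leqNgt iphi.
  by apply: phiS; apply: ltn_sub2r => //; exact: leq_ltn_trans ij.
move: lt'; set p := phi _; set q := phi _ => lt'.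
have le' : head 0 (v p) <= head 0 (v q).
  by apply: phim; rewrite leq_sub2r// ltnW.
apply: contra (vQ _ _ lt') => /orP[lts|/eqP e].
  by apply/orP; left; rewrite !sumv [X in X < _]addrC [X in _ < X]addrC oz_ltleD.
rewrite /Q !sumv {2}(vnil p) {2}(vnil q) -!/(t _) e oz_ltD2 eqseq_cons eqxx andbT.
by rewrite orbC -le_eqVlt.
Qed.

Definition monoid_span : set G :=
  [set c | exists s : seq G, (forall a, a \in s -> A a) /\ c = \sum_(a <- s) a].

Let good_pair (u : nat -> seq G) : (forall k, lists (u k)) ->
  exists i j, (i < j)%N /\ Q (u i) (u j).
Proof.
move=> uA; apply: contrapT => H; apply: (@nobad u); split => // i j ij.
by apply/negP => q; apply: H; exists i, j.
Qed.

Lemma wo_monoid_span : well_ordered monoid_span.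
Proof.
apply: wo_seqP => u /choice[s sP].
have [i [j [ij q]]] := good_pair (fun k => (sP k).1).
by exists i, j; split=> //; rewrite (sP i).2 (sP j).2; exact: Qle.
Qed.

Lemma monoid_span_size c : exists N, forall s : seq G,
  (forall a, a \in s -> A a) -> \sum_(a <- s) a = c -> (size s < N)%N.
Proof.
apply: contrapT => H.
have P N : exists s, [/\ lists s, sumg s = c & (N <= size s)%N].
  apply: contrapT => HN; apply: H; exists N => s sA sc; rewrite ltnNge.
  by apply/negP => Ns; apply: HN; exists s.
have [S SP] := choice P.
pose u k := iter k (fun s => S (size s).+1) (S 0%N).
have uP k : lists (u k) /\ sumg (u k) = c.
  by case: k => [|k]; [case: (SP 0%N)|case: (SP (size (u k)).+1)].
have us i j : (i < j)%N -> (size (u i) < size (u j))%N.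
  apply: (@iter_ltn (fun k => size (u k))) => k.
  by case: (SP (size (u k)).+1).
have [i [j [ij]]] := good_pair (fun k => (uP k).1).
rewrite /Q (uP i).2 (uP j).2 ltxx => /eqP e.
by have := us _ _ ij; rewrite e ltnn.
Qed.

End Neumann.

Arguments wo_monoid_span {G A} _ _ : rename.

Definition nonzeros (G : Type) (K : nmodType) (f : G -> K) : set G :=
  [set a | f a != 0].

Record hahn (K : realFieldType) (G : orderedAbelianGroupType) := Hahn {
  hahn_coef :> G -> K;
  hahn_wo : `[< well_ordered (nonzeros hahn_coef) >]
}.

HB.instance Definition _ K G := [isSub for @hahn_coef K G].
HB.instance Definition _ (K : realFieldType) (G : orderedAbelianGroupType) :=
  gen_eqMixin (hahn K G).
HB.instance Definition _ (K : realFieldType) (G : orderedAbelianGroupType) :=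
  gen_choiceMixin (hahn K G).

Section HahnRing.
Variables (K : realFieldType) (G : orderedAbelianGroupType).
Implicit Types (f g h : hahn K G) (a b c : G).
Local Notation supp := (@nonzeros G K).

Lemma hahnP f g : f =1 g -> f = g.
Proof. by move=> fg; apply/val_inj/funext. Qed.

Lemma supp_wo f : well_ordered (supp f).
Proof. exact/asboolP/hahn_wo. Qed.

Lemma supp0 f a : ~ supp f a -> f a = 0.
Proof. by move/negP; rewrite negbK => /eqP. Qed.

Arguments supp_wo : clear implicits.

Definition mkhahn (f : G -> K) (wf : well_ordered (supp f)) : hahn K G :=
  Hahn (asboolT wf).

Lemma wo_hahn0 : well_ordered (supp (fun=> 0)).
Proof. by apply: (wo_sub _ wo_set0) => a; rewrite /nonzeros /= eqxx. Qed.

Lemma wo_hahnN f : well_ordered (supp (fun a => - f a)).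
Proof.
by apply: (wo_sub _ (supp_wo f)) => a; rewrite /nonzeros /= oppr_eq0.
Qed.

Arguments wo_hahnN : clear implicits.

Lemma wo_hahnD f g : well_ordered (supp (fun a => f a + g a)).
Proof.
apply: (wo_sub _ (wo_setU (supp_wo f) (supp_wo g))) => a fga.
apply: contrapT => /not_orP[/supp0 fa /supp0 ga].
by move: fga; rewrite /nonzeros /= fa ga addr0 eqxx.
Qed.

Arguments wo_hahnD : clear implicits.

Definition hahn0 := mkhahn wo_hahn0.
Definition hahnN f := mkhahn (wo_hahnN f).
Definition hahnD f g := mkhahn (wo_hahnD f g).

Fact hahn_addA : associative hahnD.
Proof. by move=> f g h; apply: hahnP => a; apply: addrA. Qed.
Fact hahn_addC : commutative hahnD.
Proof. by move=> f g; apply: hahnP => a; apply: addrC. Qed.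
Fact hahn_add0 : left_id hahn0 hahnD.
Proof. by move=> f; apply: hahnP => a; apply: add0r. Qed.
Fact hahn_addN : left_inverse hahn0 hahnN hahnD.
Proof. by move=> f; apply: hahnP => a; apply: addNr. Qed.

HB.instance Definition _ :=
  GRing.isZmodule.Build (hahn K G) hahn_addA hahn_addC hahn_add0 hahn_addN.

Lemma hahn0E a : (0 : hahn K G) a = 0. Proof. by []. Qed.
Lemma hahnDE f g a : (f + g) a = f a + g a. Proof. by []. Qed.
Lemma hahnNE f a : (- f) a = - f a. Proof. by []. Qed.
Lemma hahnBE f g a : (f - g) a = f a - g a. Proof. by []. Qed.

Lemma wo_hmono (r : K) a :
  well_ordered (supp (fun b => if b == a then r else 0)).
Proof.
apply: (wo_sub _ (wo_set1 a)) => b; rewrite /nonzeros /=.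
by case: (b =P a) => //; rewrite eqxx.
Qed.

Arguments wo_hmono : clear implicits.

Definition hmono (r : K) (a : G) : hahn K G := mkhahn (wo_hmono r a).

Lemma hmonoE r a b : hmono r a b = if b == a then r else 0.
Proof. by []. Qed.

(* only finitely many terms are nonzero: see cfiber_fin *)
Definition conv f g c : K := \sum_(a \in [set: G]) f a * g (c - a).

Definition cfiber f g c := [set a | supp f a /\ supp g (c - a)].

Lemma cfiber_fin f g c : finite_set (cfiber f g c).
Proof. exact: wo_fiber (supp_wo f) (supp_wo g). Qed.

Lemma convE (s : seq G) f g c : uniq s -> cfiber f g c `<=` [set` s] ->
  conv f g c = \sum_(a <- s) f a * g (c - a).
Proof.
move=> us fs; rewrite /conv (fsbigE s)//.
  by apply: eq_bigl => a; rewrite in_setT.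
move=> a _ as_; apply: contraNeq as_ => fga; apply: fs; split.
  by apply: contraNneq fga => ->; rewrite mul0r.
by apply: contraNneq fga => ->; rewrite mulr0.
Qed.

Lemma finite_uniq (A : set G) : finite_set A ->
  exists s, uniq s /\ A `<=` [set` s].
Proof.
case/finite_seqP => s ->; exists (undup s); split; first exact: undup_uniq.
by move=> a /=; rewrite mem_undup.
Qed.

Lemma conv_supp f g : supp (conv f g) `<=` sumset (supp f) (supp g).
Proof.
move=> c fgc; apply: contrapT => H; move: fgc.
rewrite /nonzeros /= (convE (s := [::])) ?big_nil ?eqxx// => a [fa ga].
by case: H; exists a, (c - a); split=> //; rewrite addrC subrK.
Qed.

Arguments conv_supp : clear implicits.

Lemma wo_conv f g : well_ordered (supp (conv f g)).
Proof.
exact: (wo_sub (conv_supp f g) (wo_sumset (supp_wo f) (supp_wo g))).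
Qed.

Arguments wo_conv : clear implicits.

Definition hahnM f g := mkhahn (wo_conv f g).

Fact hahn_mulC : commutative hahnM.
Proof.
move=> f g; apply: hahnP => c /=.
have [s [us fs]] := finite_uniq (cfiber_fin f g c).
have subI : injective (fun a => c - a).
  by move=> a b /addrI/oppr_inj.
rewrite (convE us fs) (convE (s := [seq c - a | a <- s])).
- by rewrite big_map; apply: eq_bigr => a _; rewrite subKr mulrC.
- by rewrite map_inj_uniq.
move=> a [ga fa]; apply/mapP; exists (c - a); last by rewrite subKr.
by apply: fs; split; rewrite //= subKr.
Qed.

Fact hahn_mulDl : left_distributive hahnM +%R.
Proof.
move=> f g h; apply: hahnP => c /=.
have [s [us fs]] : exists s, uniq s /\
    cfiber (f + g) h c `|` cfiber f h c `|` cfiber g h c `<=` [set` s].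
  by apply: finite_uniq; rewrite !finite_setU; split; last exact: cfiber_fin;
    split; exact: cfiber_fin.
rewrite !(convE us); last 3 first.
- by move=> a ha; apply: fs; right.
- by move=> a ha; apply: fs; left; right.
- by move=> a ha; apply: fs; left; left.
by rewrite -big_split/=; apply: eq_bigr => a _; rewrite mulrDl.
Qed.

Fact hahn_mul1 : left_id (hmono 1 0) hahnM.
Proof.
move=> f; apply: hahnP => c /=.
rewrite (convE (s := [:: 0])) ?big_seq1 ?hmonoE ?eqxx ?mul1r ?subr0//.
move=> a [ha _]; move: ha; rewrite /nonzeros/= mem_seq1.
by case: ifP => //; rewrite eqxx.
Qed.

Fact hahn_mulA : associative hahnM.
Proof.
move=> f g h; apply: hahnP => c /=; apply/esym.
have [X [uX XP]] : exists s, uniq s /\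
    [set d | sumset (supp f) (supp g) d /\ supp h (c - d)] `<=` [set` s].
  apply/finite_uniq/wo_fiber; last exact: supp_wo.
  by apply: wo_sumset; exact: supp_wo.
have [Y [uY YP]] : exists s, uniq s /\
    [set a | supp f a /\ sumset (supp g) (supp h) (c - a)] `<=` [set` s].
  apply/finite_uniq/wo_fiber; first exact: supp_wo.
  by apply: wo_sumset; exact: supp_wo.
rewrite (convE uX); last by move=> d [/(conv_supp _ _ _) fgd hd]; exact: XP.
rewrite (convE uY); last by move=> a [fa /(conv_supp _ _ _) ha]; exact: YP.
transitivity (\sum_(d <- X) \sum_(a <- Y) f a * g (d - a) * h (c - d)).
  apply: eq_bigr => d _; rewrite -mulr_suml.
  have [hd|/supp0->] := pselect (supp h (c - d)); last by rewrite !mulr0.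
  congr (_ * _); apply: convE => // a [fa ga]; apply: YP; split => //.
  exists (d - a), (c - d); split=> //.
  by rewrite [RHS]addrC addrA subrK.
rewrite exchange_big/=; apply: eq_bigr => a _.
have [fa|/supp0 f0] := pselect (supp f a); last first.
  by rewrite f0 mul0r; apply: big1 => d _; rewrite !mul0r.
under eq_bigr do rewrite -mulrA; rewrite -mulr_sumr; congr (_ * _).
rewrite (convE (s := [seq d - a | d <- X])).
- by rewrite big_map; apply: eq_bigr => d _; rewrite opprB addrA subrK.
- by rewrite map_inj_uniq// => x y /addIr.
move=> b [gb hb]; apply/mapP; exists (a + b); last by rewrite addrC addKr.
apply: XP; split; first by exists a, b.
by rewrite opprD addrA.
Qed.

Fact hahn_one_neq0 : hmono 1 0 != 0.
Proof.
apply/eqP => /(congr1 (fun f : hahn K G => f 0)).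
by rewrite hmonoE eqxx => /eqP; rewrite oner_eq0.
Qed.

HB.instance Definition _ := GRing.Zmodule_isComNzRing.Build (hahn K G)
  hahn_mulA hahn_mulC hahn_mul1 hahn_mulDl hahn_one_neq0.

Lemma hahn1E a : (1 : hahn K G) a = (a == 0)%:R.
Proof. by rewrite [LHS]hmonoE; case: eqP. Qed.

Lemma hahnME f g c : (f * g) c = \sum_(a \in [set: G]) f a * g (c - a).
Proof. by []. Qed.

Lemma hahnM_supp f g : supp (f * g) `<=` sumset (supp f) (supp g).
Proof. exact: conv_supp. Qed.

Arguments hahnM_supp : clear implicits.

Lemma hahnMmono f r a c : (hmono r a * f) c = r * f (c - a).
Proof.
rewrite [LHS](convE (s := [:: a])) ?big_seq1 ?hmonoE ?eqxx//.
move=> b [ha _]; move: ha; rewrite /nonzeros/= mem_seq1.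
by case: ifP => //; rewrite eqxx.
Qed.

(* the minimum of the support; the value at f = 0 is a dummy *)
Definition hval f : G :=
  xget 0 [set a | f a != 0 /\ forall b, f b != 0 -> a <= b].

Lemma hvalP f : f != 0 -> f (hval f) != 0 /\ forall b, f b != 0 -> hval f <= b.
Proof.
move=> f0; apply: (@xgetPex _ 0 [set a | f a != 0 /\ forall b, f b != 0 -> a <= b]).
have [|m fm mP] := supp_wo f _ (@subset_refl _ _); last by exists m.
apply: contrapT => nf; case/eqP: f0; apply: hahnP => a.
by apply: supp0 => fa; apply: nf; exists a.
Qed.

Lemma hval_unique f a : f a != 0 -> (forall b, f b != 0 -> a <= b) -> hval f = a.
Proof.
move=> fa aP; have f0 : f != 0 by apply: contraNneq fa => ->.
have [fv vP] := hvalP f0; apply: le_anti; by rewrite vP//= aP.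
Qed.

Lemma hval_lt f b : f != 0 -> b < hval f -> f b = 0.
Proof.
move=> f0 bv; apply/eqP; rewrite -[_ == _]negbK; apply/negP => /(hvalP f0).2.
by rewrite oz_leNgt bv.
Qed.

Definition infinitesimal f := forall a, f a != 0 -> 0 < a.

Lemma exp_supp (A : set G) f n a : supp f `<=` A -> (f ^+ n) a != 0 ->
  exists s : seq G, [/\ forall b, b \in s -> A b, size s = n
    & a = \sum_(b <- s) b].
Proof.
move=> fA; elim: n a => [|n IH] a.
  rewrite expr0 hahn1E; have [-> _|_] := eqVneq a 0; last by rewrite eqxx.
  by exists [::]; rewrite big_nil.
rewrite exprS => /(hahnM_supp _ _ _)[b [c [fb /IH[s [sA ss ->]] ->]]].
exists (b :: s); split; last by rewrite big_cons.
  by move=> x; rewrite inE => /orP[/eqP->|]; [exact: fA|exact: sA].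
by rewrite /= ss.
Qed.

Lemma geom_supp f :
  supp (fun a => \sum_(n \in [set: nat]) (f ^+ n) a) `<=` monoid_span (supp f).
Proof.
move=> a fa; apply: contrapT => H; move: fa.
rewrite /nonzeros/= fsbig1 ?eqxx// => n _.
apply/eqP; rewrite -[_ == _]negbK; apply/negP => /(exp_supp (@subset_refl _ _)).
by move=> [s [sA _ e]]; apply: H; exists s.
Qed.

Lemma wo_geom f : infinitesimal f ->
  well_ordered (supp (fun a => \sum_(n \in [set: nat]) (f ^+ n) a)).
Proof.
by move=> fi; apply: (wo_sub (@geom_supp f)); apply: wo_monoid_span (supp_wo f) fi.
Qed.

Lemma hahn_sumE (I : Type) (r : seq I) (P : pred I) (F : I -> hahn K G) a :
  (\sum_(i <- r | P i) F i) a = \sum_(i <- r | P i) F i a.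
Proof. by elim/big_rec2: _ => // i x y _; rewrite hahnDE => ->. Qed.

Lemma geom_trunc f a : infinitesimal f -> exists N, forall m, (N <= m)%N ->
  (f ^+ m) a = 0 /\
  \sum_(n \in [set: nat]) (f ^+ n) a = (\sum_(n < m) f ^+ n) a.
Proof.
move=> fi; have [N NP] := monoid_span_size (supp_wo f) fi a.
have f0 m : (N <= m)%N -> (f ^+ m) a = 0.
  move=> Nm; apply/eqP; rewrite -[_ == _]negbK; apply/negP.
  move=> /(exp_supp (@subset_refl _ _))[s [sA ss e]].
  by have := NP s sA (esym e); rewrite ss ltnNge Nm.
exists N => m Nm; split; first exact: f0.
rewrite hahn_sumE (fsbigE (iota 0 m)) ?iota_uniq//.
  rewrite -(big_mkord predT (fun n => (f ^+ n) a)) /index_iota subn0.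
  by apply: eq_bigl => n; rewrite in_setT.
move=> n _; rewrite mem_iota add0n -leqNgt => mn; apply: f0.
exact: leq_trans mn.
Qed.

Lemma geom_inv f : infinitesimal f -> exists g, (1 - f) * g = 1.
Proof.
move=> fi; exists (mkhahn (wo_geom fi)); set g := mkhahn _.
apply: hahnP => c.
(* compare g with a partial sum at the finitely many points involved *)
have [s [us fs]] : exists s, uniq s /\
    [set a | supp (1 - f) a /\ monoid_span (supp f) (c - a)] `<=` [set` s].
  apply/finite_uniq/wo_fiber; first exact: supp_wo.
  exact: wo_monoid_span (supp_wo f) fi.
have [M MP] : exists M, forall m, (M <= m)%N ->
    forall a, a \in s -> g (c - a) = (\sum_(n < m) f ^+ n) (c - a).
  elim: s {us fs} => [|a s [M IH]]; first by exists 0%N.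
  have [N NP] := geom_trunc (c - a) fi; exists (maxn M N) => m.
  rewrite geq_max => /andP[Mm Nm] b; rewrite inE => /orP[/eqP->|].
    exact: (NP m Nm).2.
  exact: IH.
have [N NP] := geom_trunc c fi.
pose m := maxn M N.
have -> : ((1 - f) * g) c = ((1 - f) * \sum_(n < m) f ^+ n) c.
  rewrite [LHS](convE us); last by move=> a [fa /geom_supp ga]; apply: fs.
  rewrite [RHS](convE us).
    by apply: eq_big_seq => a /(MP _ (leq_maxl M N)) ->.
  move=> a [fa ga]; apply: fs; split => //; move: ga.
  rewrite /nonzeros/= hahn_sumE => ga.
  have [n fn] : exists n, supp (f ^+ n) (c - a).
    apply: contrapT => H; move: ga; rewrite big1 ?eqxx// => n _.
    by apply: supp0 => fn; apply: H; exists n.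
  by have [t [tA _ ->]] := exp_supp (@subset_refl _ _) fn; exists t.
rewrite -opprB mulNr -subrX1 opprB hahnBE.
by rewrite (NP m (leq_maxr M N)).1 subr0.
Qed.

Lemma hahn_inv_ex f : f != 0 -> exists g, g * f = 1.
Proof.
move=> f0; have [fv vP] := hvalP f0.
pose u := 1 - hmono (f (hval f))^-1 (- hval f) * f.
have ui : infinitesimal u.
  move=> a; rewrite /u hahnBE hahn1E hahnMmono opprK.
  have [->|a0] := eqVneq a 0; first by rewrite add0r mulVf// subrr eqxx.
  rewrite sub0r oppr_eq0 mulf_eq0 negb_or => /andP[_ /vP].
  by rewrite -[X in X <= _]add0r oz_leD2 lt_neqAle eq_sym a0.
have [g gE] := geom_inv ui.
exists (g * hmono (f (hval f))^-1 (- hval f)).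
by rewrite -mulrA mulrC -gE /u opprB addrC subrK.
Qed.

Definition hahnV f : hahn K G :=
  xget 0 [set g | f != 0 /\ g * f = 1].

Fact hahn_mulV f : f != 0 -> hahnV f * f = 1.
Proof.
move=> f0; rewrite /hahnV; have [g gf] := hahn_inv_ex f0.
by apply: (xgetPex 0 _ : [set g | f != 0 /\ g * f = 1] _).2; exists g.
Qed.

Fact hahn_inv0 : hahnV 0 = 0.
Proof. by rewrite /hahnV xgetPN// => g [/eqP]. Qed.

HB.instance Definition _ :=
  GRing.ComNzRing_isField.Build (hahn K G) hahn_mulV hahn_inv0.

Definition hlead f : K := f (hval f).

Lemma hlead0 : hlead 0 = 0. Proof. by []. Qed.

Lemma hlead_eq0 f : (hlead f == 0) = (f == 0).
Proof.
apply/idP/idP => [|/eqP->]; last by rewrite hlead0.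
by apply: contraLR => /hvalP[].
Qed.

Lemma hval_leadM f g : f != 0 -> g != 0 ->
  hval (f * g) = hval f + hval g /\ hlead (f * g) = hlead f * hlead g.
Proof.
move=> f0 g0; have [fv vf] := hvalP f0; have [gv vg] := hvalP g0.
have E : (f * g) (hval f + hval g) = hlead f * hlead g.
  rewrite [LHS](convE (s := [:: hval f]))//; first rewrite big_seq1.
    by rewrite [_ + _ - _]addrC addKr.
  move=> a [fa ga]; rewrite /= mem_seq1 eq_le vf// andbT.
  by have := vg _ ga; rewrite -(oz_leD2 a) subrK addrC oz_leD2.
have V : hval (f * g) = hval f + hval g.
  apply: hval_unique; first by rewrite E mulf_neq0 // hlead_eq0.
  by move=> _ /(hahnM_supp _ _ _)[a [b [/vf fa /vg gb ->]]]; exact: oz_leD.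
by rewrite /hlead V E.
Qed.

Lemma hleadN f : hlead (- f) = - hlead f.
Proof.
have [->|f0] := eqVneq f 0; first by rewrite oppr0 hlead0 oppr0.
have [fv vf] := hvalP f0; suff V : hval (- f) = hval f by rewrite /hlead V.
by apply: hval_unique => [|b]; rewrite hahnNE oppr_eq0//; exact: vf.
Qed.

Definition hle f g := 0 <= hlead (g - f).
Definition hlt f g := 0 < hlead (g - f).
Definition hnorm f := if 0 <= hlead f then f else - f.

Fact hle0E f : hle 0 f = (0 <= hlead f). Proof. by rewrite /hle subr0. Qed.

Fact hle0_add f g : hle 0 f -> hle 0 g -> hle 0 (f + g).
Proof.
rewrite !hle0E; have [->|f0] := eqVneq f 0; first by rewrite add0r.
have [->|g0] := eqVneq g 0; first by rewrite addr0.
have [fv vf] := hvalP f0; have [gv vg] := hvalP g0 => lf lg.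
have {}lf : 0 < f (hval f) by rewrite lt_neqAle eq_sym fv.
have {}lg : 0 < g (hval g) by rewrite lt_neqAle eq_sym gv.
pose m := if hval f <= hval g then hval f else hval g.
have mf b : f b != 0 -> m <= b.
  move=> /vf; rewrite /m; case: ifP => // /negbT.
  by rewrite -oz_ltNge => /ltW; exact: le_trans.
have mg b : g b != 0 -> m <= b.
  by move=> /vg; rewrite /m; case: ifP => //; exact: le_trans.
have fg : 0 < (f + g) m.
  rewrite hahnDE /m; case: ifPn => [fg|].
    have [e|ne] := eqVneq (hval f) (hval g); first by rewrite addr_gt0// e.
    by rewrite (hval_lt g0) ?addr0// lt_neqAle ne.
  by rewrite -oz_ltNge => gf; rewrite (hval_lt f0)// add0r.
suff V : hval (f + g) = m by rewrite /hlead V ltW.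
apply: hval_unique => [|b]; first by rewrite gt_eqF.
have [fb|] := eqVneq (f b) 0; last by move=> /mf.
by rewrite hahnDE fb add0r => /mg.
Qed.

Fact hle0_mul f g : hle 0 f -> hle 0 g -> hle 0 (f * g).
Proof.
rewrite !hle0E; have [->|f0] := eqVneq f 0; first by rewrite mul0r hlead0.
have [->|g0] := eqVneq g 0; first by rewrite mulr0 hlead0.
by rewrite (hval_leadM f0 g0).2; exact: mulr_ge0.
Qed.

Fact hle0_anti f : hle 0 f -> hle f 0 -> f = 0.
Proof.
rewrite hle0E /hle sub0r hleadN oppr_ge0 => f1 f2; apply/eqP.
by rewrite -hlead_eq0 eq_le f1 f2.
Qed.

Fact hsub_ge0 f g : hle 0 (g - f) = hle f g.
Proof. by rewrite /hle subr0. Qed.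

Fact hle0_total f : hle 0 f || hle f 0.
Proof. by rewrite hle0E /hle sub0r hleadN oppr_ge0 le_total. Qed.

Fact hnormN f : hnorm (- f) = hnorm f.
Proof.
have [->|] := eqVneq f 0; first by rewrite oppr0.
rewrite -hlead_eq0 /hnorm hleadN oppr_ge0 opprK.
by case: (ltgtP (hlead f) 0).
Qed.

Fact hge0_norm f : hle 0 f -> hnorm f = f.
Proof. by rewrite hle0E /hnorm => ->. Qed.

Fact hlt_def f g : hlt f g = (g != f) && hle f g.
Proof.
by rewrite /hlt /hle lt_neqAle eq_sym hlead_eq0 subr_eq0.
Qed.

HB.instance Definition _ := Num.IntegralDomain_isLeReal.Build (hahn K G)
  hle0_add hle0_mul hle0_anti hsub_ge0 hle0_total hnormN hge0_norm hlt_def.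

Lemma hahn_gt0 f : (0 < f) = (0 < hlead f).
Proof. by rewrite -[LHS]/(hlt 0 f) /hlt subr0. Qed.

End HahnRing.


Definition mindex n := {ffun 'I_n -> nat}.

Definition mpow (A : comNzRingType) n (x : 'I_n -> A) (k : mindex n) : A :=
  \prod_(i < n) x i ^+ k i.

(* coefficients of the iterated formal partial derivative of order k *)
Definition mderiv (R : nzRingType) n (k : mindex n) (c : mindex n -> R) :
    mindex n -> R :=
  fun j => c [ffun i => (j i + k i)%N] * (\prod_(i < n) (j i + k i) ^_ (k i))%:R.

Definition mdelta n (i : 'I_n) : mindex n := [ffun j => (j == i) : nat].

Section HahnPowerSeries.
Variables (K : realFieldType) (G : orderedAbelianGroupType) (n : nat).
Implicit Types (d : mindex n -> K) (eps : 'I_n -> hahn K G) (a : G).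

(* Sum over k of d k * eps ^ k, for infinitesimal eps. The default value of
   insubd is not used then, and every coefficient is a finite sum: see hpowserE
   and mpow_fin (Neumann's lemma). *)
Definition hpowser d eps : hahn K G :=
  insubd (0 : hahn K G) (fun a => \sum_(k \in [set: mindex n]) d k * mpow eps k a).

Lemma mpow_supp (A : set G) eps k a :
  (forall i, nonzeros (eps i) `<=` A) -> mpow eps k a != 0 ->
  exists s : seq G, [/\ forall b, b \in s -> A b, size s = (\sum_i k i)%N
    & a = \sum_(b <- s) b].
Proof.
move=> epsA; rewrite /mpow.
elim: (index_enum _) a => [|i r IH] a.
  rewrite !big_nil hahn1E; have [-> _|_] := eqVneq a 0; last by rewrite eqxx.
  by exists [::]; rewrite big_nil.
rewrite !big_cons => /hahnM_supp[b [c []]].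
move=> /(exp_supp (epsA i))[s [sA ss ->]] /IH[t [tA st ->]] ->.
exists (s ++ t); rewrite size_cat ss st big_cat; split=> // x.
by rewrite mem_cat => /orP[/sA|/tA].
Qed.

Variable eps : 'I_n -> hahn K G.
Hypothesis eps_inf : forall i, infinitesimal (eps i).

Let A := \bigcup_i nonzeros (eps i).

Let A_wo : well_ordered A.
Proof. by apply: wo_bigcup => i; exact: supp_wo. Qed.

Let A_gt0 a : A a -> 0 < a.
Proof. by case=> i _; exact: eps_inf. Qed.

Let eps_A i : nonzeros (eps i) `<=` A.
Proof. by move=> a ea; exists i. Qed.

Lemma mpow_fin a : finite_set [set k | mpow eps k a != 0].
Proof.
have [N NP] := monoid_span_size A_wo A_gt0 a.
pose up (k : {ffun 'I_n -> 'I_N}) : mindex n := [ffun i => k i : nat].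
apply: (@sub_finite_set _ _ (up @` [set: _])); last first.
  exact/finite_image/finite_finset.
move=> k /(mpow_supp eps_A)[s [sA ss e]].
have kN i : (k i < N)%N.
  apply: leq_ltn_trans (NP s sA (esym e)).
  by rewrite ss (bigD1 i)//= leq_addr.
by exists [ffun i => Ordinal (kN i)] => //; apply/ffunP => i; rewrite !ffunE.
Qed.

Lemma hpowserE d a :
  hpowser d eps a = \sum_(k \in [set: mindex n]) d k * mpow eps k a.
Proof.
rewrite /hpowser -[LHS]/(val (insubd _ _) a) val_insubd ifT//; apply/asboolP.
apply: (wo_sub _ (wo_monoid_span A_wo A_gt0)) => b fb.
apply: contrapT => H; move: fb; rewrite /nonzeros/= fsbig1 ?eqxx// => k _.
have [->|] := eqVneq (mpow eps k b) 0; first by rewrite mulr0.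
by move=> /(mpow_supp eps_A)[s [sA _ e]]; case: H; exists s.
Qed.

End HahnPowerSeries.

Section RestrictedAnalytic.
Variable R : realType.

Definition ps_term n (c : mindex n -> R) (x : 'I_n -> R) : mindex n -> \bar R :=
  fun k => (c k * mpow x k)%:E.

(* convergence at every point of a neighbourhood of [-1, 1]^n; the open cubes
   of radius r > 1 form a basis of these neighbourhoods *)
Definition convergent n (c : mindex n -> R) : Prop :=
  exists2 r, 1 < r & forall x : 'I_n -> R, (forall i, `|x i| < r) ->
    summable [set: mindex n] (ps_term c x).

Definition ps_sum n (c : mindex n -> R) (x : 'I_n -> R) : R :=
  fine (esum [set: mindex n] (ps_term c x)^\+
        - esum [set: mindex n] (ps_term c x)^\-)%E.

(* A restricted analytic function is represented by its power series, which is
   uniquely determined by the function. *)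
Record ran n := Ran {
  ran_coef :> mindex n -> R;
  ran_cvg : convergent ran_coef
}.

Definition in_cube (A : realFieldType) n (x : 'I_n -> A) : bool :=
  [forall i, -1 <= x i <= 1].

Definition ran_fun n (c : ran n) (x : 'I_n -> R) : R :=
  if in_cube x then ps_sum c x else 0.

Definition ps_taylor n (c : mindex n -> R) (x : 'I_n -> R) : mindex n -> R :=
  fun k => ps_sum (mderiv k c) x / (\prod_(i < n) (k i)`!)%:R.

Definition ran_hahn (G : orderedAbelianGroupType) n (c : ran n)
    (y : 'I_n -> hahn R G) : hahn R G :=
  if in_cube y then (* y i 0 is the real part of y i, the rest infinitesimal *)
    hpowser (ps_taylor c (fun i => y i 0)) (fun i => y i - hmono (y i 0) 0)
  else 0.

Definition deriv_closed (F : forall n, set (ran n)) : Prop :=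
  forall n (c : ran n), F n c -> forall i : 'I_n,
    exists2 c' : ran n, F n c' & ran_coef c' = mderiv (mdelta i) c.

(* f restricted to the compact interval [a, b], which is mapped affinely to
   [-1, 1] *)
Definition has_restriction (F : forall n, set (ran n)) (f : R -> R) (a b : R) :
    Prop :=
  exists2 c : ran 1, F 1%N c & forall t : R, -1 <= t <= 1 ->
    ran_fun c (fun=> t) = f ((a + b) / 2 + (b - a) / 2 * t).

Definition has_restricted_exp (F : forall n, set (ran n)) : Prop :=
  exists a b, a < b /\ has_restriction F expR a b.

Definition has_restricted_log (F : forall n, set (ran n)) : Prop :=
  exists a b, [/\ 0 < a, a < 1, 1 < b & has_restriction F (@ln R) a b].

End RestrictedAnalytic.

(* A formula m has its free variables in 'I_m, FAll binding the variable ord0,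
   so that formula 0 is the type of sentences. *)
Section FirstOrder.
Variable R : realType.

Inductive term (m : nat) : Type :=
| TVar of 'I_m
| TZero
| TOne
| TAdd of term m & term m
| TOpp of term m
| TMul of term m & term m
| TFun n of ran R n & ('I_n -> term m)
| TExp of term m.

Inductive formula : nat -> Type :=
| FEq m of term m & term m : formula m
| FLt m of term m & term m : formula m
| FFalse m : formula m
| FImp m of formula m & formula m : formula m
| FAll m of formula m.+1 : formula m.

(* interpretation of the symbols that are not part of the ordered field *)
Record an_exp_structure (A : Type) := AnExpStructure {
  an_fun : forall n, ran R n -> ('I_n -> A) -> A;
  an_exp : A -> A
}.

Section Satisfaction.
Variables (A : realFieldType) (S : an_exp_structure A).

Fixpoint teval m (e : 'I_m -> A) (t : term m) : A :=
  match t with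
  | TVar i => e i
  | TZero => 0
  | TOne => 1
  | TAdd t1 t2 => teval e t1 + teval e t2
  | TOpp t1 => - teval e t1
  | TMul t1 t2 => teval e t1 * teval e t2
  | TFun n c ts => an_fun S c (fun i => teval e (ts i))
  | TExp t1 => an_exp S (teval e t1)
  end.

Definition env_cons m (a : A) (e : 'I_m -> A) : 'I_m.+1 -> A :=
  fun i => if unlift ord0 i is Some j then e j else a.

Fixpoint fsat m (phi : formula m) : ('I_m -> A) -> Prop :=
  match phi in formula m return ('I_m -> A) -> Prop with
  | FEq _ t1 t2 => fun e => teval e t1 = teval e t2
  | FLt _ t1 t2 => fun e => teval e t1 < teval e t2
  | FFalse _ => fun=> False
  | FImp _ p q => fun e => fsat p e -> fsat q e
  | FAll _ p => fun e => forall a, fsat p (env_cons a e)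
  end.

Definition holds (phi : formula 0) : Prop := fsat phi (fun=> 0).

End Satisfaction.

Definition real_an_exp : an_exp_structure R := AnExpStructure (@ran_fun R) expR.

Definition T_an_exp : set (formula 0) := [set phi | holds real_an_exp phi].

Definition is_model (A : realFieldType) (S : an_exp_structure A) : Prop :=
  forall phi, T_an_exp phi -> holds S phi.

End FirstOrder.

Section Subfields.
Variables (R : realType) (F : forall n, set (ran R n)).

Definition subfield (A : fieldType) (S : set A) : Prop :=
  [/\ S 1, forall x y, S x -> S y -> S (x - y)
    & forall x y, S x -> S y -> S (x / y)].

Definition fun_closed (A : Type) (I : forall n, ran R n -> ('I_n -> A) -> A)
    (S : set A) : Prop :=
  forall n (c : ran R n), F c -> forall y : 'I_n -> A,
    (forall i, S (y i)) -> S (I n c y).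

(* Num.real_closed_axiom for the ordered subfield S *)
Definition real_closed_subfield (A : realFieldType) (S : set A) : Prop :=
  forall p : {poly A}, (forall i, S p`_i) -> forall a b, S a -> S b ->
    a <= b -> p.[a] <= 0 <= p.[b] ->
    exists2 x, S x /\ a <= x <= b & root p x.

(* S contains its relative algebraic closure in A, which is its real closure
   when A is real closed *)
Definition closed_under_real_closure (A : realFieldType) (S : set A) : Prop :=
  forall p : {poly A}, p != 0 -> (forall i, S p`_i) ->
    forall x, root p x -> S x.

Section Model.
Variables (M : realFieldType) (S : an_exp_structure R M) (iota : R -> M).

(* R, with the functions from F and exp, is a substructure of M via iota; the
   ring operations are dealt with by iota being a morphism *)
Definition is_substructure : Prop :=
  [/\ forall a b, (iota a < iota b) = (a < b),
      forall n (c : ran R n), F c -> forall y : 'I_n -> R,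
        iota (ran_fun c y) = an_fun S c (iota \o y)
    & forall a, iota (expR a) = an_exp S (iota a)].

Definition LE_closed (D : set M) : Prop :=
  [/\ subfield D, closed_under_real_closure D, fun_closed (@an_fun R M S) D,
      forall y, D y -> D (an_exp S y)
    & forall y z, D y -> 0 < y -> an_exp S z = y -> D z].

Definition LE (x : M) : set M := smallest LE_closed (range iota `|` [set x]).

Section Embedding.
Variable G : orderedAbelianGroupType.

Record is_LF_embedding (D : set M) (sigma : M -> hahn R G) : Prop := {
  emb0 : sigma 0 = 0;
  emb1 : sigma 1 = 1;
  embD : forall y z, D y -> D z -> sigma (y + z) = sigma y + sigma z;
  embN : forall y, D y -> sigma (- y) = - sigma y;
  embM : forall y z, D y -> D z -> sigma (y * z) = sigma y * sigma z;
  emb_lt : forall y z, D y -> D z -> (sigma y < sigma z) = (y < z);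
  emb_fun : forall n (c : ran R n), F c -> forall y : 'I_n -> M,
    (forall i, D (y i)) -> sigma (an_fun S c y) = ran_hahn c (sigma \o y)
}.

End Embedding.
End Model.

Section Hahn.
Variable G : orderedAbelianGroupType.
Implicit Types (L : set (hahn R G)) (f : hahn R G).

(* v f >= 0 and v f > 0, with v 0 infinite *)
Definition v_ge0 f := (f == 0) || (0 <= hval f).
Definition v_gt0 f := (f == 0) || (0 < hval f).

(* Hensel's lemma for a simple root of the residue polynomial *)
Definition henselian L : Prop :=
  forall p : {poly hahn R G}, (forall i, L p`_i /\ v_ge0 p`_i) ->
    forall a, L a -> v_ge0 a -> v_gt0 p.[a] ->
    p^`().[a] != 0 -> hval p^`().[a] = 0 ->
    exists b, [/\ L b, root p b & v_gt0 (b - a)].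

Definition value_group L : set G := (@hval R G) @` (L `\ 0).

Definition is_cross_section L (pi : G -> hahn R G) : Prop :=
  (forall a, value_group L a -> [/\ L (pi a), pi a != 0 & hval (pi a) = a]) /\
  (forall a b, value_group L a -> value_group L b -> pi (a + b) = pi a * pi b).

Definition canonical_cross_section : G -> hahn R G := hmono 1.

Definition rF_closure (P : set (hahn R G)) : set (hahn R G) :=
  smallest (fun L => [/\ subfield L, fun_closed (@ran_hahn R G) L,
                         henselian L & real_closed_subfield L])
    (range (fun r => hmono r 0) `|` P).

End Hahn.
End Subfields.

Definition bounded_away0 (G : orderedAbelianGroupType) (S : set G) : Prop :=
  exists b c : G, [/\ b < 0, 0 < c & forall a, S a -> ~~ (b < a < c)].

(* Main.v *)
Require Import Defs.
From HB Require Import structures.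
From mathcomp Require Import all_boot all_order all_algebra finmap.
From mathcomp Require Import mathcomp_extra boolp classical_sets functions.
From mathcomp Require Import cardinality fsbigop reals ereal topology.
From mathcomp Require Import normedtype sequences numfun esum exp.
From mathcomp Require Import ring.

(** Write V for the value group of L.  The exponents of a given element of L
all lie in a subgroup of G of finite rational rank, while V has arbitrarily
small archimedean classes, since L is closed under logarithms; so some
archimedean class lies below all the exponents.

In detail, call a series of finite rank if its support lies in the pure hull
(the relative divisible hull in G) of a finite subset of V.  The series of
finite rank in L contain the constants and the monomials of [pi V], and they
satisfy the closure conditions which define [R(pi V)^rF]; since L is the
smallest such field, every element of L has finite rank.  Only two closure
conditions need an idea.
- Real closure.  L is real closed, because it is isomorphic to a relatively
  algebraically closed subfield of a model of the theory of the reals.  If D is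
  a pure subgroup of G, the field R((D)) is relatively algebraically closed in
  R((G)) ([hahn_on_relatively_closed]): removing from an algebraic element its
  part in R((D)) leaves an algebraic element z, and if z is nonzero then its
  valuation has no nonzero multiple in D; so the terms of a polynomial in z
  over R((D)) have distinct valuations and cannot cancel.  Hence a root in L of
  a polynomial with coefficients of finite rank has finite rank.
- Hensel's lemma follows from the intermediate value property, as a simple
  residual root produces a sign change between infinitely close points
  ([real_closed_henselian]).

For the small archimedean classes, let y in L be positive and infinite.  Then
[log y] is infinite and [(log y / n)^n < y] for all n, so that the positive
element [- v (log y)] of V generates a convex subgroup which does not contain
[v y] ([image_log]).  An induction on the number of generators shows that the
pure hull of a finite subset of V meets some nonzero convex subgroup trivially
([pure_hull_avoids]); a generator of this convex subgroup, and its opposite,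
bound the support away from 0. *)

Set Implicit Arguments.
Unset Strict Implicit.
Unset Printing Implicit Defensive.
Import Order.TTheory GRing.Theory Num.Theory.
Local Open Scope classical_set_scope.
Local Open Scope ring_scope.

(** * Pure hulls and convex subgroups *)

Section OrderedGroups.
Variable G : orderedAbelianGroupType.
Implicit Types (a b g : G) (A D : set G).

Definition subgroup D := D 0 /\ forall a b, D a -> D b -> D (a - b).

Definition pure_subgroup D :=
  subgroup D /\ forall n a, D (a *+ n.+1) -> D a.

Definition pure_hull A := smallest pure_subgroup A.

(** For [0 <= g], this is the convex subgroup generated by [g]; the smaller it
is, the smaller the archimedean class of [g]. *)
Definition convex_span g := [set a | exists k, - (g *+ k) <= a <= g *+ k].

Lemma subgroupB D a b : subgroup D -> D a -> D b -> D (a - b).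
Proof. by case=> _; exact. Qed.

Lemma subgroupN D a : subgroup D -> D a -> D (- a).
Proof. by move=> [D0 DB] Da; rewrite -sub0r; exact: DB. Qed.

Lemma subgroupD D a b : subgroup D -> D a -> D b -> D (a + b).
Proof.
by move=> sD Da Db; rewrite -(opprK b); apply: sD.2 => //; exact: subgroupN.
Qed.

Lemma subgroupMn D a n : subgroup D -> D a -> D (a *+ n).
Proof.
move=> sD Da; elim: n => [|n IH]; first by rewrite mulr0n; exact: sD.1.
by rewrite mulrS; exact: subgroupD.
Qed.

Lemma subgroupMz D a (k : int) : subgroup D -> D a -> D (a *~ k).
Proof.
move=> sD Da; case: k => n; first exact: subgroupMn.
by rewrite NegzE mulrNz; apply: subgroupN => //; exact: subgroupMn.
Qed.

Lemma subgroup_sum D (s : seq G) : subgroup D -> (forall a, a \in s -> D a) ->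
  D (\sum_(a <- s) a).
Proof.
move=> sD; elim: s => [|a s IH] sub; first by rewrite big_nil; exact: sD.1.
rewrite big_cons; apply: subgroupD => //; first by apply: sub; rewrite mem_head.
by apply: IH => b bs; apply: sub; rewrite inE bs orbT.
Qed.

Lemma pure_subgroupMz D a (k : int) :
  pure_subgroup D -> k != 0 -> D (a *~ k) -> D a.
Proof.
move=> [sD pD]; case: k => [[//|n]|n] _; first exact: pD.
by rewrite NegzE mulrNz => /(subgroupN sD); rewrite opprK; exact: pD.
Qed.

Lemma pure_hull_pure A : pure_subgroup (pure_hull A).
Proof.
split=> [|n a h D [pD AD]]; last by apply: pD.2 (h D _).
split=> [D [pD _]|a b ha hb D DA]; first exact: pD.1.1.
by apply: DA.1.1.2; [exact: ha|exact: hb].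
Qed.

Lemma sub_pure_hull A : A `<=` pure_hull A.
Proof. exact: sub_gen_smallest. Qed.

Lemma pure_hull_min A D : pure_subgroup D -> A `<=` D -> pure_hull A `<=` D.
Proof. exact: smallest_sub. Qed.

Lemma pure_hullS A B : A `<=` B -> pure_hull A `<=` pure_hull B.
Proof.
move=> AB; apply: pure_hull_min (pure_hull_pure B) _.
exact: subset_trans (@sub_pure_hull B).
Qed.

Lemma oz_oppr_le a b : (- a <= - b) = (b <= a).
Proof. by rewrite -[LHS](oz_leD2 (a + b)) addKr addrA addrAC addNr add0r. Qed.

Lemma oz_oppr_gt0 a : (0 < - a) = (a < 0).
Proof. by rewrite -[LHS](oz_ltD2 a) add0r addNr. Qed.

Lemma oz_mulrn_ge0 g k : 0 <= g -> 0 <= g *+ k.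
Proof.
move=> g0; elim: k => [|k IH]; first by rewrite mulr0n.
by rewrite mulrS -[leLHS]add0r; exact: oz_leD.
Qed.

Lemma oz_mulrn_gt0 a n : 0 < a -> 0 < a *+ n.+1.
Proof.
move=> a0; rewrite mulrS -[ltLHS]add0r; apply: oz_ltleD => //.
exact/oz_mulrn_ge0/ltW.
Qed.

Lemma oz_mulrn_eq0 a n : a *+ n.+1 = 0 -> a = 0.
Proof.
case/orP: (oz_le_total 0 a); rewrite le_eqVlt => /orP[/eqP//|a0].
  by move=> e; have := oz_mulrn_gt0 n a0; rewrite e ltxx.
move: a0; rewrite -oz_oppr_gt0 => /(oz_mulrn_gt0 n).
by rewrite mulNrn => + e; rewrite e oppr0 ltxx.
Qed.

Lemma pure_subgroup0 : pure_subgroup [set 0 : G].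
Proof.
split=> [|n a /oz_mulrn_eq0//]; split=> // a b /= -> ->; exact: subrr.
Qed.

Lemma convex_span_le g a : 0 <= a -> a <= g -> convex_span g a.
Proof.
move=> a0 ag; exists 1%N; rewrite mulr1n ag andbT; apply: (le_trans _ a0).
by rewrite -[leRHS]oppr0 oz_oppr_le; exact: le_trans a0 ag.
Qed.

Lemma convex_span_pure g : 0 <= g -> pure_subgroup (convex_span g).
Proof.
move=> g0; split=> [|n a [k /andP[ka ak]]].
  split; first by exists 0%N; rewrite mulr0n oppr0 lexx.
  move=> a b [k /andP[ka ak]] [l /andP[lb bl]]; exists (k + l)%N.
  rewrite mulrnDr opprD !oz_leD// ?oz_oppr_le//.
  by rewrite -[leRHS]opprK oz_oppr_le.
have gk := oz_mulrn_ge0 k g0; exists k; apply/andP; split.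
  rewrite oz_leNgt; apply/negP => ak'; move: ka; rewrite oz_leNgt => /negP; apply.
  rewrite mulrS -[ltRHS]addr0; apply: oz_ltleD => //.
  have a0 : 0 <= - a.
    rewrite -[leLHS]oppr0 oz_oppr_le; apply: ltW; apply: lt_le_trans ak' _.
    by rewrite -[leRHS]oppr0 oz_oppr_le.
  by rewrite -oz_oppr_le oppr0 -mulNrn; exact: oz_mulrn_ge0.
rewrite oz_leNgt; apply/negP => ka'; move: ak; rewrite oz_leNgt => /negP; apply.
rewrite mulrS -[ltLHS]addr0; apply: oz_ltleD => //.
by apply: oz_mulrn_ge0; apply: le_trans gk _; exact: ltW.
Qed.

Lemma convex_spanS g a : 0 <= a -> convex_span g a ->
  convex_span a `<=` convex_span g.
Proof.
move=> a0 [k /andP[_ ak]] b [l /andP[lb bl]]; exists (k * l)%N.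
have akl : a *+ l <= g *+ (k * l).
  rewrite mulrnA; elim: l {lb bl} => [|l IH]; first by rewrite !mulr0n.
  by rewrite !mulrS; exact: oz_leD.
apply/andP; split; last exact: le_trans akl.
by apply: le_trans lb; rewrite oz_oppr_le.
Qed.

(** Lets an induction on the generators of a pure hull eliminate them one at a
time. *)
Lemma pure_hull_cons A b g : pure_hull (b |` A) g ->
  exists n (k : int), pure_hull A (g *+ n.+1 - b *~ k).
Proof.
have [sH pH] := pure_hull_pure A.
pose D := [set g | exists n (k : int), pure_hull A (g *+ n.+1 - b *~ k)].
suff : pure_hull (b |` A) `<=` D by exact.
apply: pure_hull_min; last first.
  move=> a [->|Aa]; first by exists 0%N, 1; rewrite mulr1n mulr1z subrr; exact: sH.1.
  by exists 0%N, 0; rewrite mulr1n mulr0z subr0; exact: sub_pure_hull.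
split=> [|m a [n [k]]]; last first.
  by exists (m.+1 * n.+1).-1, k; rewrite prednK// mulrnA.
split=> [|a a' [n [k h]] [n' [k' h']]].
  by exists 0%N, 0; rewrite mul0rn mulr0z subrr; exact: sH.1.
exists (n.+1 * n'.+1).-1, (k * n'.+1 - k' * n.+1); rewrite prednK//.
suff -> : (a - a') *+ (n.+1 * n'.+1) - b *~ (k * n'.+1 - k' * n.+1) =
    (a *+ n.+1 - b *~ k) *+ n'.+1 - (a' *+ n'.+1 - b *~ k') *+ n.+1.
  by apply: (subgroupB sH); exact: (subgroupMn _ sH).
rewrite !pmulrn !PoszM !mulrzBl mulrzBr !mulrzA.
rewrite -!(mulrzA a') (mulrC n'.+1%:Z) !opprB !addrA.
by rewrite addrAC [RHS]addrAC; congr (_ + _); rewrite addrAC.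
Qed.

Lemma pure_hull_subgroup (V : set G) e : subgroup V -> pure_hull V e ->
  exists n, V (e *+ n.+1).
Proof.
move=> sV; pose D := [set e | exists n, V (e *+ n.+1)].
suff : pure_hull V `<=` D by exact.
apply: pure_hull_min => [|a Va]; last by exists 0%N; rewrite mulr1n.
split=> [|m a [n]]; last by exists (m.+1 * n.+1).-1; rewrite prednK// mulrnA.
split=> [|a b [n Va] [m Vb]]; first by exists 0%N; rewrite mul0rn; exact: sV.1.
exists (n.+1 * m.+1).-1; rewrite prednK// mulrnBl.
by apply: sV.2; [|rewrite mulnC]; rewrite mulrnA; exact: subgroupMn.
Qed.

(** The pure hull of a finite set has finitely many archimedean classes, and G
has a class below each class of V, so some convex subgroup lies below all of
them.  Adding a generator [b] adds at
most one class: two elements of the larger hull which are both small are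
rationally dependent, since eliminating [b] between them gives a small element
of the old hull, that is, 0.  So if the new hull has a small nonzero element
[e], any convex subgroup which avoids [e] avoids the new hull. *)
Lemma pure_hull_avoids (V : set G) : pure_subgroup V ->
  (exists g : G, 0 < g) ->
  (forall e, V e -> e != 0 -> exists2 g, 0 < g & ~ convex_span g e) ->
  forall s : seq G, [set` s] `<=` V ->
  exists2 g, 0 < g & pure_hull [set` s] `&` convex_span g `<=` [set 0].
Proof.
move=> pV [g0 g0_gt0] small; elim=> [|b s IH] sV.
  exists g0 => // a [Ha _]; apply: (pure_hull_min pure_subgroup0 _ Ha) => c /=.
  by rewrite in_nil.
have [|g g_gt0 gP] := IH; first by move=> a /= sa; apply: sV; rewrite /= inE sa orbT.
have e_cons : [set` b :: s] = b |` [set` s].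
  apply/seteqP; split=> a /=; rewrite inE.
    by case/orP => [/eqP->|]; [left|right].
  by case=> [->|->]; rewrite ?eqxx ?orbT.
rewrite e_cons.
have [[e [He Ce]]|ne] := pselect
    (exists e, pure_hull (b |` [set` s]) e /\ (convex_span g e /\ e != 0));
    last first.
  exists g => // a [Ha Ca]; apply/eqP; rewrite -[_ == _]negbK.
  by apply/negP => a0; apply: ne; exists a.
case: Ce => Ce e0.
have Ve : V e by apply: (pure_hull_min pV _ He); rewrite -e_cons.
have [h h_gt0 Ch] := small e Ve e0.
exists h => // a [Ha Ca].
have pg := convex_span_pure (ltW g_gt0); have ph := convex_span_pure (ltW h_gt0).
have hg : convex_span g h.
  case/orP: (oz_le_total h g) => hg; first exact: (convex_span_le (ltW h_gt0)).
  case: Ch; apply: convex_spanS Ce; first exact: ltW.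
  exact: (convex_span_le (ltW g_gt0)).
have Cga : convex_span g a by apply: convex_spanS Ca => //; exact: ltW.
have [n [k nk]] := pure_hull_cons Ha.
have [m [l ml]] := pure_hull_cons He.
have [sH pH] := pure_hull_pure [set` s].
(* eliminating b gives an element of the old hull in the span of g, that is, 0 *)
have rel : a *+ n.+1 *~ l = e *+ m.+1 *~ k.
  apply/eqP; rewrite -subr_eq0; apply/eqP; apply: gP; split; last first.
    by apply: pg.1.2; apply: subgroupMz pg.1 _; apply: subgroupMn pg.1 _.
  have -> : a *+ n.+1 *~ l - e *+ m.+1 *~ k =
     (a *+ n.+1 - b *~ k) *~ l - (e *+ m.+1 - b *~ l) *~ k.
    by rewrite !mulrzBl -!mulrzA (mulrC l) opprB addrA subrK.
  by apply: (subgroupB sH); exact: (subgroupMz _ sH).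
have [k0|k0] := eqVneq k 0.
  apply: gP; split => //; apply: (pH n).
  by move: nk; rewrite k0 mulr0z subr0.
case: Ch; apply: (ph.2 m); apply: (pure_subgroupMz ph k0).
by rewrite -rel; apply: subgroupMz ph.1 _; apply: subgroupMn ph.1 _.
Qed.

End OrderedGroups.

(** * Series with exponents in a pure subgroup *)

Section PolyOver.
Variables (A : comNzRingType) (S : set A).
Hypotheses (S0 : S 0) (SD : forall x y, S x -> S y -> S (x + y))
  (SM : forall x y, S x -> S y -> S (x * y)).

Let S_sum (I : Type) (r : seq I) (P : pred I) (u : I -> A) :
  (forall i, S (u i)) -> S (\sum_(i <- r | P i) u i).
Proof. by move=> uS; apply: (big_ind S). Qed.

Lemma comp_poly_coef_closed (p q : {poly A}) :
  (forall i, S p`_i) -> (forall i, S q`_i) -> forall i, S (p \Po q)`_i.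
Proof.
elim/poly_ind: p => [|p c IH] pS qS i; first by rewrite comp_poly0 coef0.
have {IH}pS' : forall i, S (p \Po q)`_i.
  apply: IH => // j; have := pS j.+1.
  by rewrite coefD coefMX coefC addr0.
rewrite comp_poly_MXaddC coefD; apply: SD.
  by rewrite coefM; apply: S_sum => j; exact: SM.
rewrite coefC; case: eqP => // _.
by have := pS 0%N; rewrite coefD coefMX coefC add0r.
Qed.

End PolyOver.

Section HahnOn.
Variables (K : realFieldType) (G : orderedAbelianGroupType).
Implicit Types (f g : hahn K G) (a b : G) (D : set G) (p : {poly hahn K G}).

Definition hahn_on D : set (hahn K G) := [set f | nonzeros f `<=` D].

Lemma hahn_on0 D : hahn_on D 0.
Proof. by move=> a; rewrite /nonzeros /= eqxx. Qed.

Lemma hahn_on_mono D r a : D a -> hahn_on D (hmono r a).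
Proof.
move=> Da b; rewrite /nonzeros /=.
by have [-> _|_] := eqVneq b a; [exact: Da|rewrite eqxx].
Qed.

Lemma hahn_onN D f : hahn_on D f -> hahn_on D (- f).
Proof. by move=> Df a; rewrite /nonzeros /= oppr_eq0; exact: Df. Qed.

Lemma hahn_onD D f g : hahn_on D f -> hahn_on D g -> hahn_on D (f + g).
Proof.
move=> Df Dg a; rewrite /nonzeros /=.
have [-> fg|fa _] := eqVneq (f a) 0; last exact: Df.
by apply: Dg; rewrite /nonzeros /= -[g a]add0r.
Qed.

Lemma hahn_onB D f g : hahn_on D f -> hahn_on D g -> hahn_on D (f - g).
Proof. by move=> Df Dg; apply: hahn_onD => //; exact: hahn_onN. Qed.

Lemma hahn_on_mul D1 D2 D f g : (forall a b, D1 a -> D2 b -> D (a + b)) ->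
  hahn_on D1 f -> hahn_on D2 g -> hahn_on D (f * g).
Proof. by move=> DD Df Dg _ /hahnM_supp[a [b [/Df fa /Dg gb ->]]]; exact: DD. Qed.

Lemma hahn_onM D f g : subgroup D ->
  hahn_on D f -> hahn_on D g -> hahn_on D (f * g).
Proof. by move=> sD; apply: hahn_on_mul => a b; exact: (subgroupD sD). Qed.

Lemma wo_hrestrict D f :
  well_ordered (nonzeros (fun a => if `[< D a >] then f a else 0)).
Proof.
apply: (wo_sub _ (@supp_wo _ _ f)) => a; rewrite /nonzeros /=.
by case: ifP => // _; rewrite eqxx.
Qed.

Definition hrestrict D f : hahn K G := mkhahn (@wo_hrestrict D f).

Lemma hrestrictE D f a : hrestrict D f a = if `[< D a >] then f a else 0.
Proof. by []. Qed.

Lemma hrestrict_on D f : hahn_on D (hrestrict D f).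
Proof.
by move=> a; rewrite /nonzeros /=; case: asboolP => // _; rewrite eqxx.
Qed.

Lemma hrestrict_id D f : hahn_on D f -> hrestrict D f = f.
Proof.
move=> Df; apply: hahnP => a; rewrite hrestrictE; case: asboolP => // nD.
by apply/esym/eqP; rewrite -[_ == _]negbK; apply/negP => /Df.
Qed.

(** R((G)) is graded by the cosets of D, hence taking the part in R((D)) is
linear over R((D)). *)
Lemma hrestrictM D f g : subgroup D -> hahn_on D f ->
  hrestrict D (f * g) = f * hrestrict D g.
Proof.
move=> sD Df; apply: hahnP => c; rewrite hrestrictE.
case: asboolP => Dc; last first.
  apply/esym/eqP; rewrite -[_ == _]negbK; apply/negP => H; apply: Dc.
  exact: (hahn_onM sD Df (@hrestrict_on D g)).
rewrite !hahnME; apply: eq_fsbigr => a _; rewrite hrestrictE.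
have [->|fa] := eqVneq (f a) 0; first by rewrite !mul0r.
by rewrite asboolT//; apply: subgroupB sD _ _ => //; exact: Df.
Qed.

Lemma hahn_on1 D : D 0 -> hahn_on D 1.
Proof. exact: hahn_on_mono. Qed.

(** By linearity of the restriction, [f] times the part of its inverse in R((D))
is the part of 1 in R((D)), that is, 1. *)
Lemma hahn_onV D f : subgroup D -> hahn_on D f -> hahn_on D f^-1.
Proof.
move=> sD Df; have [->|f0] := eqVneq f 0; first by rewrite invr0; exact: hahn_on0.
have : f * hrestrict D f^-1 = 1.
  by rewrite -hrestrictM// divff// hrestrict_id//; exact: hahn_on1 sD.1.
move=> /(congr1 ( *%R f^-1)); rewrite mulKf// mulr1 => <-.
exact: hrestrict_on.
Qed.

Lemma hvalX f n : f != 0 -> hval (f ^+ n) = hval f *+ n.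
Proof.
move=> f0; elim: n => [|n IH].
  rewrite expr0 mulr0n; apply: hval_unique => [|b]; rewrite hahn1E ?eqxx ?oner_eq0//.
  by have [->|_] := eqVneq b 0; rewrite ?lexx// eqxx.
by rewrite exprS (hval_leadM f0 (expf_neq0 _ f0)).1 IH mulrS.
Qed.

Lemma hvalV f : f != 0 -> hval f^-1 = - hval f.
Proof.
move=> f0; apply/eqP; rewrite -addr_eq0 addrC -(hval_leadM _ _).1 ?invr_eq0//.
by rewrite mulfV// -(expr0 f) hvalX.
Qed.

Lemma hvalD f g : f != 0 -> hval f < hval g ->
  f + g != 0 /\ hval (f + g) = hval f.
Proof.
move=> f0 fg; have [fv vf] := hvalP f0.
have E : (f + g) (hval f) != 0.
  have [->|g0] := eqVneq g 0; first by rewrite addr0.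
  by rewrite hahnDE (hval_lt g0 fg) addr0.
split; first by apply: contraNneq E => ->.
apply: hval_unique => // b; rewrite hahnDE.
have [->|fb _] := eqVneq (f b) 0; last exact: vf.
rewrite add0r => gb; have g0 : g != 0 by apply: contraNneq gb => ->.
by apply: ltW; apply: lt_le_trans fg _; exact: (hvalP g0).2.
Qed.

(** The term of least valuation cannot be cancelled. *)
Lemma sum_distinct_hval (I : eqType) (r : seq I) (u : I -> hahn K G) :
  r != [::] -> uniq r -> (forall i, i \in r -> u i != 0) ->
  {in r &, injective (fun i => hval (u i))} ->
  \sum_(i <- r) u i != 0 /\
  exists2 i, i \in r & hval (\sum_(i <- r) u i) = hval (u i).
Proof.
elim: r => // i [|j r] IH _ /andP[ir ur] u0 uinj.
  by rewrite big_seq1; split; [apply: u0|exists i]; rewrite ?mem_head.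
have [||||s0 [k kr sk]] := IH; [by []|by []| | |].
- by move=> k kr; apply: u0; rewrite inE kr orbT.
- by move=> k l kr lr; apply: uinj; rewrite inE ?kr ?lr orbT.
have ne : hval (u i) != hval (\sum_(i <- j :: r) u i).
  rewrite sk; apply: contra ir => /eqP e.
  by rewrite (uinj i k _ _ e) ?inE ?eqxx// -in_cons kr orbT.
have i0 : u i != 0 by apply: u0; rewrite mem_head.
rewrite big_cons.
case/orP: (oz_le_total (hval (u i)) (hval (\sum_(i <- j :: r) u i))) => h.
  have [|n0 e] := @hvalD (u i) (\sum_(i <- j :: r) u i) i0.
    by rewrite lt_neqAle ne.
  by split=> //; exists i => //; rewrite mem_head.
have [|n0 e] := @hvalD (\sum_(i <- j :: r) u i) (u i) s0.
  by rewrite lt_neqAle eq_sym ne.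
rewrite addrC; split=> //; exists k; first by rewrite inE kr orbT.
by rewrite e.
Qed.

(** Let [z] be the part of [f] outside D.  It is algebraic over R((D)) too, but
if it is nonzero then, D being pure, the multiples of its valuation lie in
pairwise distinct cosets of D; the nonzero terms [q`_i * z ^+ i] of a
polynomial over R((D)) then have distinct valuations, and [q.[z] != 0]. *)
Lemma hahn_on_relatively_closed D p f : pure_subgroup D -> p != 0 ->
  (forall i, hahn_on D p`_i) -> root p f -> hahn_on D f.
Proof.
move=> [sD pD] p0 pS rpf.
pose g := hrestrict D f; pose z := f - g.
have gD : hahn_on D g by exact: hrestrict_on.
suff : z = 0 by move/eqP; rewrite subr_eq0 => /eqP ->.
apply/eqP; rewrite -[_ == _]negbK; apply/negP => z0.
pose q := p \Po ('X + g%:P).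
have qS i : hahn_on D q`_i.
  apply: comp_poly_coef_closed => //.
  - exact: hahn_on0.
  - by move=> x y; exact: hahn_onD.
  - by move=> x y; exact: hahn_onM.
  move=> j; rewrite coefD coefX coefC; apply: hahn_onD.
    by case: eqP => _; [exact: hahn_on1 sD.1|exact: hahn_on0].
  by case: eqP => _ //; exact: hahn_on0.
have q0 : q != 0.
  rewrite /q comp_poly_eq0 ?size_XaddC//.
have qz : q.[z] = 0.
  by rewrite horner_comp hornerD hornerX hornerC subrK; exact/eqP.
have zD : ~ D (hval z).
  have [zv _] := hvalP z0; move=> Dv; case/negP: zv; apply/eqP.
  by rewrite hahnBE hrestrictE asboolT// subrr.
pose r := [seq i <- iota 0 (size q) | q`_i != 0].
have : \sum_(i <- r) q`_i * z ^+ i != 0.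
  apply: (sum_distinct_hval _ _ _ _).1.
  - rewrite -size_eq0 size_filter -lt0n -has_count; apply/hasP.
    exists (size q).-1; last by rewrite -/(lead_coef q) lead_coef_eq0.
    by rewrite mem_iota /= ltn_predL size_poly_gt0.
  - by rewrite filter_uniq// iota_uniq.
  - by move=> i; rewrite mem_filter => /andP[qi _]; rewrite mulf_neq0// expf_neq0.
  move=> i j; rewrite !mem_filter => /andP[qi _] /andP[qj _] /=.
  rewrite !(hval_leadM _ _).1 ?expf_neq0// !hvalX//.
  wlog ij : i j qi qj / (i <= j)%N.
    by move=> H e; case/orP: (leq_total i j) => ij; [|apply/esym]; exact: H.
  move: ij; rewrite leq_eqVlt => /orP[/eqP//|ij] e; case: zD.
  have /(pD (j - i.+1)%N) // : D (hval z *+ (j - i.+1).+1).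
  have -> : hval z *+ (j - i.+1).+1 = hval q`_i - hval q`_j.
    rewrite subnSK// mulrnBr 1?ltnW//; apply: (addIr (hval q`_j)).
    by rewrite subrK addrC addrA -e addrK.
  apply: subgroupB sD _ _; apply: qS; exact: (hvalP _).1.
case/negP; rewrite -[X in _ == X]qz horner_coef.
rewrite big_filter big_mkcond/= -(big_mkord predT (fun i => q`_i * z ^+ i)).
rewrite /index_iota subn0; apply/eqP/eq_bigr => i _.
by case: eqP => //= ->; rewrite mul0r.
Qed.

End HahnOn.

Section RanHahnOn.
Variables (R : realType) (G : orderedAbelianGroupType).

(** The exponents of a power series in [eps] are sums of exponents of [eps],
also when the default value of [hpowser] occurs. *)
Lemma hpowser_on (D : set G) n (d : mindex n -> R) (eps : 'I_n -> hahn R G) :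
  subgroup D -> (forall i, hahn_on D (eps i)) -> hahn_on D (hpowser d eps).
Proof.
move=> sD epsD a ha; apply: contrapT => nDa; case/negP: ha; apply/eqP.
suff e : \sum_(k \in [set: mindex n]) d k * mpow eps k a = 0.
  rewrite /hpowser -[LHS]/(val (insubd _ _) a) val_insubd.
  by case: ifP.
rewrite fsbig1// => k _; have [->|] := eqVneq (mpow eps k a) 0.
  by rewrite mulr0.
move=> /(mpow_supp epsD)[s [sA _ e]]; case: nDa; rewrite e.
exact: subgroup_sum.
Qed.

Lemma ran_hahn_on (D : set G) n (c : ran R n) (y : 'I_n -> hahn R G) :
  subgroup D -> (forall i, hahn_on D (y i)) -> hahn_on D (ran_hahn c y).
Proof.
move=> sD yD; rewrite /ran_hahn; case: ifP => _; last exact: hahn_on0.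
apply: hpowser_on => // i; apply: hahn_onB => //.
by apply: hahn_on_mono; exact: sD.1.
Qed.

End RanHahnOn.

(** * Henselianity from sign changes *)

Section Subfield.
Variables (A : fieldType) (S : set A).
Hypothesis sS : subfield S.

Lemma subfieldB x y : S x -> S y -> S (x - y).
Proof. by case: sS => _ SB _; exact: SB. Qed.

Lemma subfield1 : S 1. Proof. by case: sS. Qed.

Lemma subfield0 : S 0.
Proof. by rewrite -(subrr 1); apply: subfieldB; exact: subfield1. Qed.

Lemma subfieldN x : S x -> S (- x).
Proof. by move=> Sx; rewrite -sub0r; apply: subfieldB => //; exact: subfield0. Qed.

Lemma subfieldD x y : S x -> S y -> S (x + y).
Proof. by move=> Sx Sy; rewrite -(opprK y); apply/subfieldB/subfieldN. Qed.

Lemma subfieldV x : S x -> S x^-1.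
Proof.
by case: sS => S1 _ SV Sx; rewrite -div1r; exact: SV.
Qed.

Lemma subfieldM x y : S x -> S y -> S (x * y).
Proof.
by move=> Sx Sy; rewrite -(invrK y); case: sS => _ _; apply => //; exact: subfieldV.
Qed.

Lemma subfield_nat n : S n%:R.
Proof.
elim: n => [|n IH]; first exact: subfield0.
by rewrite mulrS; apply: subfieldD => //; exact: subfield1.
Qed.

End Subfield.

(** Stated over a subset closed under the operations, so that it applies both to
a subfield and to the valuation ring. *)
Lemma horner_taylor2 (A : comNzRingType) (S : set A)
    (S0 : S 0) (SD : forall x y, S x -> S y -> S (x + y))
    (SM : forall x y, S x -> S y -> S (x * y)) (p : {poly A}) a h :
  (forall i, S p`_i) -> S a -> S h ->
  [/\ S p.[a], S p^`().[a]
    & exists2 r, S r & p.[a + h] = p.[a] + p^`().[a] * h + h ^+ 2 * r].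
Proof.
elim/poly_ind: p => [|p c IH] pS Sa Sh.
  by rewrite deriv0 !horner0; split => //; exists 0; rewrite // mul0r mulr0 !addr0.
have Sc : S c by have := pS 0%N; rewrite coefD coefMX coefC add0r.
have [|||Sp Sp' [r Sr e]] := IH => // [i|].
  by have := pS i.+1; rewrite coefD coefMX coefC addr0.
rewrite derivD derivM derivX derivC addr0 mulr1 !hornerE e.
split; [by apply: SD => //; exact: SM|by apply: SD => //; exact: SM|].
exists (r * (a + h) + p^`().[a]); last by ring.
by apply: (SD) => //; apply: SM => //; exact: SD.
Qed.

Lemma real_closed_sign_change (A : realFieldType) (S : set A) (p : {poly A}) a b :
  subfield S -> real_closed_subfield S -> (forall i, S p`_i) -> S a -> S b ->
  p.[a] * p.[b] <= 0 -> exists x, [/\ S x, root p x & `|x - a| <= `|b - a|].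
Proof.
move=> sS rcS.
suff ivt (q : {poly A}) c d : (forall i, S q`_i) -> S c -> S d -> c <= d ->
    q.[c] * q.[d] <= 0 -> exists2 x, S x /\ c <= x <= d & root q x.
  move=> pS Sa Sb pab; case/orP: (le_total a b) => ab.
    have [x [Sx /andP[ax xb]] px] := ivt p a b pS Sa Sb ab pab.
    by exists x; split=> //; rewrite !ger0_norm ?subr_ge0 ?lerD2r.
  rewrite mulrC in pab; have [x [Sx /andP[bx xa]] px] := ivt p b a pS Sb Sa ab pab.
  by exists x; split=> //; rewrite !ler0_norm ?subr_le0// lerN2 lerD2r.
move=> qS Sc Sd cd qcd.
have [qc|qc] := lerP q.[c] 0.
  have [qd|qd] := lerP 0 q.[d]; first by apply: rcS => //; rewrite qc.
  have {}qc : q.[c] = 0.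
    by apply/eqP; rewrite eq_le qc/= leNgt; apply/negP => qc';
       move: qcd; rewrite leNgt nmulr_rgt0// qd.
  by exists c; [rewrite lexx|apply/eqP].
have qd : q.[d] <= 0 by move: qcd; rewrite pmulr_rle0.
have [||x Sx rx] := rcS (- q) _ c d Sc Sd cd.
- by move=> i; rewrite coefN; exact: subfieldN.
- by rewrite !hornerN oppr_le0 oppr_ge0 ltW.
by exists x => //; rewrite -rootN.
Qed.

Section Valuation.
Variables (R : realType) (G : orderedAbelianGroupType).
Implicit Types (f g : hahn R G) (a b : G).

Lemma v_ge0P f : v_ge0 f <-> hahn_on [set a | 0 <= a] f.
Proof.
rewrite /v_ge0; have [->|f0] := eqVneq f 0.
  by split=> // _; exact: hahn_on0.
split=> [/= h a fa|h]; first exact: le_trans h ((hvalP f0).2 _ fa).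
exact: h (hvalP f0).1.
Qed.

Lemma v_gt0P f : v_gt0 f <-> hahn_on [set a | 0 < a] f.
Proof.
rewrite /v_gt0; have [->|f0] := eqVneq f 0.
  by split=> // _; exact: hahn_on0.
split=> [/= h a fa|h]; first exact: lt_le_trans h ((hvalP f0).2 _ fa).
exact: h (hvalP f0).1.
Qed.

Lemma v_ge0D f g : v_ge0 f -> v_ge0 g -> v_ge0 (f + g).
Proof. by move=> /v_ge0P ? /v_ge0P ?; apply/v_ge0P; exact: hahn_onD. Qed.

Lemma v_ge0M f g : v_ge0 f -> v_ge0 g -> v_ge0 (f * g).
Proof.
move=> /v_ge0P f0 /v_ge0P g0; apply/v_ge0P.
apply: hahn_on_mul f0 g0 => a b /= a0 b0.
by rewrite -[leLHS]add0r; exact: oz_leD.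
Qed.

Lemma v_gt0M f g : v_gt0 f -> v_ge0 g -> v_gt0 (f * g).
Proof.
move=> /v_gt0P f0 /v_ge0P g0; apply/v_gt0P.
apply: hahn_on_mul f0 g0 => a b /= a0 b0.
by rewrite -[ltLHS]add0r; exact: oz_ltleD.
Qed.

Lemma v_ge0_nat n : v_ge0 (n%:R : hahn R G).
Proof.
elim: n => [|n IH]; first by rewrite /v_ge0 eqxx.
by rewrite mulrS; apply: v_ge0D => //; apply/v_ge0P; apply: hahn_on1; exact: lexx.
Qed.

Lemma hvalN f : hval (- f) = hval f.
Proof.
have [->|f0] := eqVneq f 0; first by rewrite oppr0.
by have [fv vf] := hvalP f0; apply: hval_unique => [|b];
  rewrite hahnNE oppr_eq0//; exact: vf.
Qed.

Lemma hval_norm f : hval `|f| = hval f.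
Proof.
case/orP: (le_total 0 f) => f0; first by rewrite ger0_norm.
by rewrite ler0_norm// hvalN.
Qed.

Lemma hahn_ge0 f : (0 <= f) = (0 <= hlead f).
Proof. exact: hle0E. Qed.

(** If [hval f < hval g], the leading term of [g - f] is that of [- f], which is
negative. *)
Lemma hval_le f g : 0 < f -> f <= g -> hval g <= hval f.
Proof.
move=> f_gt0; rewrite -subr_ge0 oz_leNgt => fg; apply/negP => vfg.
have f0 : f != 0 by rewrite gt_eqF.
have [||_ e] := @hvalD R G (- f) g; rewrite ?oppr_eq0 ?hvalN//.
move: fg; rewrite addrC hahn_ge0 /hlead e hvalN hahnDE hahnNE.
have -> : g (hval f) = 0.
  by have [->//|g0] := eqVneq g 0; exact: hval_lt.
by rewrite addr0 oppr_ge0 leNgt -/(hlead f) -hahn_gt0 f_gt0.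
Qed.

Lemma v_gt0_convex f g : `|f| <= `|g| -> v_gt0 g -> v_gt0 f.
Proof.
rewrite /v_gt0; have [->//|f0] := eqVneq f 0.
move=> fg; have g0 : g != 0.
  by rewrite -normr_gt0; apply: lt_le_trans fg; rewrite normr_gt0.
rewrite (negPf g0)/= => g_gt0; apply: (lt_le_trans g_gt0).
by rewrite -hval_norm -(hval_norm f); apply: hval_le => //; rewrite normr_gt0.
Qed.

Lemma v_gt0_lt1 f : v_gt0 f -> f < 1.
Proof.
move=> /v_gt0P fi; have f0 a : a <= 0 -> f a = 0.
  move=> a0; apply/eqP; rewrite -[_ == _]negbK; apply/negP => /fi/=.
  by rewrite oz_ltNge a0.
have v0 : hval (1 - f) = 0.
  apply: hval_unique => [|b]; rewrite hahnBE hahn1E.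
    by rewrite eqxx f0// subr0 oner_eq0.
  case/orP: (oz_le_total 0 b) => // b0; rewrite f0// subr0.
  by have [->|_] := eqVneq b 0; rewrite ?lexx// eqxx.
by rewrite -subr_gt0 hahn_gt0 /hlead v0 hahnBE hahn1E eqxx f0// subr0.
Qed.

(** Let [c = p.[a]] be infinitesimal and [d = p^`().[a]] a unit.  The Newton
step from [a] to [a - c / d] nearly reaches a root, so twice this step overshoots it:
with [h = - 2 c / d], the value at [a + h] is [- c * (1 - u)] for an
infinitesimal [u], and there is a root between [a] and [a + h]. *)
Lemma real_closed_henselian (S : set (hahn R G)) :
  subfield S -> real_closed_subfield S -> henselian S.
Proof.
move=> sS rcS p pS a Sa a_ge0 pa d0 vd.
have p_ge0 i : v_ge0 p`_i by case: (pS i).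
have Sp i : S p`_i by case: (pS i).
set c := p.[a] in pa; set d := p^`().[a] in d0 vd.
have [c0|c0] := eqVneq c 0.
  by exists a; split=> //; [apply/eqP|rewrite subrr /v_gt0 eqxx].
have [Sc Sd _] :=
  horner_taylor2 (subfield0 sS) (subfieldD sS) (subfieldM sS) Sp Sa Sa.
have dV : v_ge0 d^-1.
  rewrite /v_ge0 invr_eq0 (negPf d0)/=.
  by rewrite hvalV// vd oppr0 lexx.
pose h := - (2%:R * c / d).
have h_gt0 : v_gt0 h.
  rewrite /h (_ : - _ = c * (- 1 * (2%:R * d^-1))); last by ring.
  apply: v_gt0M => //; apply: v_ge0M; last by apply: v_ge0M => //; exact: v_ge0_nat.
  by apply/v_ge0P; apply: hahn_onN; apply: hahn_on1; exact: lexx.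
have h_ge0 : v_ge0 h by move: h_gt0 => /orP[h0|/ltW h0]; rewrite /v_ge0 h0 ?orbT.
have v00 : v_ge0 (0 : hahn R G) by rewrite /v_ge0 eqxx.
have [_ _ [r r_ge0 e]] :=
  horner_taylor2 (S := @v_ge0 R G) v00 v_ge0D v_ge0M p_ge0 a_ge0 h_ge0.
have Sh : S h.
  apply: (subfieldN sS); apply: (subfieldM sS); last exact: subfieldV.
  by apply: (subfieldM sS) => //; exact: subfield_nat.
have [|b [Sb pb ba]] := real_closed_sign_change sS rcS Sp Sa (subfieldD sS Sa Sh).
  pose u := c * (4%:R * (r * (d^-1 * d^-1))).
  have u1 : u < 1.
    apply: v_gt0_lt1; apply: v_gt0M => //; apply: v_ge0M.
      exact: v_ge0_nat.
    by apply: v_ge0M => //; exact: v_ge0M.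
  have -> : p.[a + h] = - (c * (1 - u)).
    by rewrite e -/c -/d /u /h; field.
  rewrite -/c mulrN oppr_le0 mulrA mulr_ge0//; first by rewrite -expr2 sqr_ge0.
  by rewrite subr_ge0 ltW.
exists b; split => //; apply: v_gt0_convex ba _.
by rewrite addrC addKr.
Qed.

End Valuation.

(** * First-order consequences of the theory of the reals with exponentiation *)

Section Formulas.
Variable R : realType.

Definition FNot m (p : formula R m) := FImp p (FFalse R m).

Fixpoint universal_closure m : formula R m -> formula R 0 :=
  match m with
  | 0 => id
  | m'.+1 => fun p => universal_closure (FAll p)
  end.

Definition horner_term m (cs : seq (term R m)) (t : term R m) : term R m :=
  foldr (fun c u => TAdd (TMul u t) c) (TZero R m) cs.

Definition var m (i : nat) (im : (i < m)%N) : term R m := TVar R (Ordinal im).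

Definition ivt_coefs n : seq 'I_(2 + n) := [seq rshift 2 i | i <- enum 'I_n].

(** The intermediate value property of a polynomial with [n] coefficients; the
free variables are the two end points, then the coefficients. *)
Definition ivt_formula n : formula R (2 + n) :=
  let a := TVar R (lshift n ord0) in let b := TVar R (lshift n ord_max) in
  let p := horner_term [seq TVar R i | i <- ivt_coefs n] in
  let x := TVar R ord0 in
  let a' := TVar R (lift ord0 (lshift n ord0)) in
  let b' := TVar R (lift ord0 (lshift n ord_max)) in
  let p' := horner_term [seq TVar R (lift ord0 i) | i <- ivt_coefs n] in
  FImp (FNot (FLt b a))
    (FImp (FNot (FLt (TZero R _) (p a))) (FImp (FNot (FLt (p b) (TZero R _)))
      (FNot (FAll (FImp (FNot (FLt x a')) (FImp (FNot (FLt b' x))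
        (FNot (FEq (p' x) (TZero R _))))))))).

Section Semantics.
Variables (A : realFieldType) (S : an_exp_structure R A).

Lemma holds_universal_closure m (p : formula R m) :
  holds S (universal_closure p) <-> forall e, fsat S p e.
Proof.
elim: m p => [|m IH] p /=.
  split=> [h e|]; last exact.
  by rewrite (_ : e = (fun=> 0)) //; apply/funext => -[].
rewrite IH /=; split=> [h e|h e a]; last exact: h.
rewrite (_ : e = env_cons (e ord0) (fun i => e (lift ord0 i))); first exact: h.
by apply/funext => i; rewrite /env_cons; case: unliftP => [j|] ->.
Qed.

Lemma teval_horner m (e : 'I_m -> A) cs t :
  teval S e (horner_term cs t) = (Poly (map (teval S e) cs)).[teval S e t].
Proof. by rewrite horner_Poly; elim: cs => //= c cs ->. Qed.

Lemma fsat_ivt n (e : 'I_(2 + n) -> A) :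
  let p := Poly [seq e i | i <- ivt_coefs n] in
  let a := e (lshift n ord0) in let b := e (lshift n ord_max) in
  fsat S (ivt_formula n) e <->
  (a <= b -> p.[a] <= 0 <= p.[b] -> exists2 x, a <= x <= b & root p x).
Proof.
have E x : [seq teval S (env_cons x e) i | i <-
    [seq TVar R (lift ord0 i) | i <- ivt_coefs n]] = [seq e i | i <- ivt_coefs n].
  by rewrite -map_comp; apply: eq_map => i; rewrite /= /env_cons liftK.
rewrite /= !teval_horner -map_comp /=.
have E' x t : teval S (env_cons x e) (horner_term
    [seq TVar R (lift ord0 i) | i <- ivt_coefs n] t) =
    (Poly [seq e i | i <- ivt_coefs n]).[teval S (env_cons x e) t].
  by rewrite teval_horner E.
have nlt (x y : A) : ~ x < y -> y <= x by rewrite leNgt => /negP.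
have nle (x y : A) : x <= y -> ~ y < x by rewrite leNgt => /negP.
split=> h.
  move=> ab /andP[pa pb]; apply: contrapT => nx.
  apply: (h (nle _ _ ab) (nle _ _ pa) (nle _ _ pb)) => x.
  rewrite E' /= /env_cons !liftK unlift_none => /nlt ax /nlt xb /eqP px.
  by apply: nx; exists x; rewrite ?ax.
move=> /nlt ab /nlt pa /nlt pb nx.
have [|x /andP[ax xb] /eqP px] := h ab; first by rewrite pa.
apply: (nx x); rewrite ?E' /= /env_cons ?liftK ?unlift_none //; exact: nle.
Qed.

End Semantics.

(** Parameters are allowed: the universal closure of the formula is a sentence
of the theory. *)
Lemma transfer (M : realFieldType) (S : an_exp_structure R M) m (p : formula R m) :
  is_model S -> (forall e, fsat (real_an_exp R) p e) -> forall e, fsat S p e.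
Proof.
move=> mS h; apply/holds_universal_closure/mS.
exact/(holds_universal_closure (real_an_exp R) p).2.
Qed.

Section Model.
Variables (M : realFieldType) (S : an_exp_structure R M).
Hypothesis mS : is_model S.

Lemma model_ivt (p : {poly M}) a b : a <= b -> p.[a] <= 0 <= p.[b] ->
  exists2 x, a <= x <= b & root p x.
Proof.
set n := size p; pose e (i : 'I_(2 + n)) := (a :: b :: (p : seq M))`_i.
have <- : Poly [seq e i | i <- ivt_coefs n] = p.
  rewrite -map_comp; apply/polyP => i; rewrite coef_Poly.
  have [ip|ip] := ltnP i n; last first.
    by rewrite !nth_default// size_map size_enum_ord.
  rewrite (nth_map (Ordinal ip)) ?size_enum_ord//= /e /=.
  by rewrite nth_enum_ord.
have := @transfer M S _ (ivt_formula n) mS _ e.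
move=> /(_ _)/fsat_ivt; apply => e'; apply/fsat_ivt; exact: poly_ivt.
Qed.

Lemma model_expD z w : an_exp S (z + w) = an_exp S z * an_exp S w.
Proof.
pose v0 := var (isT : 0 < 2)%N; pose v1 := var (isT : 1 < 2)%N.
apply: (transfer (p := FEq (TExp (TAdd v0 v1)) (TMul (TExp v0) (TExp v1))) mS _
  (fun i => [:: z; w]`_i)) => e /=; exact: expRD.
Qed.

Lemma model_exp_lt z w : z < w -> an_exp S z < an_exp S w.
Proof.
pose v0 := var (isT : 0 < 2)%N; pose v1 := var (isT : 1 < 2)%N.
apply: (transfer (p := FImp (FLt v0 v1) (FLt (TExp v0) (TExp v1))) mS _
  (fun i => [:: z; w]`_i)) => e /=; by rewrite ltr_expR.
Qed.

Lemma model_lt_exp z : z < an_exp S z.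
Proof.
pose v0 := var (isT : 0 < 1)%N.
apply: (transfer (p := FLt v0 (TExp v0)) mS _ (fun=> z)) => e /=.
by apply: lt_le_trans (expR_ge1Dx _); rewrite ltrDr.
Qed.

Lemma model_log y : 0 < y -> exists z, an_exp S z = y.
Proof.
pose v0 := var (isT : 0 < 2)%N; pose v1 := var (isT : 1 < 2)%N.
pose p := FImp (FLt (TZero R 1) (var (isT : 0 < 1)%N))
  (FNot (FAll (FNot (FEq (TExp v0) v1)))).
move=> y0; apply: contrapT => nz.
have E (A : realFieldType) (S' : an_exp_structure R A) (e : 'I_1 -> A) :
    fsat S' p e <-> (0 < e ord0 -> ~ forall x, an_exp S' x <> e ord0).
  have e0 i : e i = e ord0 by rewrite ord1.
  have E0 x : env_cons x e (Ordinal (isT : 0 < 2)%N) = x.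
    by rewrite /env_cons; case: unliftP => // j [].
  have E1 x : env_cons x e (Ordinal (isT : 1 < 2)%N) = e ord0.
    by rewrite /env_cons; case: unliftP => [j _|/(congr1 val)//].
  rewrite /= e0; split=> h u0 z; apply: (h u0) => x.
    by rewrite E0 E1; exact: z.
  by move: (z x); rewrite E0 E1.
have : fsat S p (fun=> y).
  apply: (transfer mS) => e; apply/E => e0 h.
  by apply: (h (ln (e ord0))); exact: lnK.
by move=> /E; apply => // x e; apply: nz; exists x.
Qed.

End Model.
End Formulas.

(** * The image of a field closed under logarithms *)

Section Infinite.
Variables (R : realType) (G : orderedAbelianGroupType).
Implicit Types (f : hahn R G).

Lemma hahn_nat_coef n (a : G) : a != 0 -> (n%:R : hahn R G) a = 0.
Proof.
move=> a0; elim: n => [//|n IH].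
by rewrite mulrS hahnDE hahn1E (negPf a0) add0r.
Qed.

Lemma hahn_nat_coef0 n : (n%:R : hahn R G) 0 = n%:R.
Proof.
elim: n => [//|n IH]; by rewrite mulrS hahnDE hahn1E eqxx IH -mulrS.
Qed.

Lemma hval_nat n : hval (n.+1%:R : hahn R G) = 0.
Proof.
apply: hval_unique => [|b]; first by rewrite hahn_nat_coef0 pnatr_eq0.
by have [->|b0] := eqVneq b 0; rewrite ?lexx// hahn_nat_coef ?eqxx.
Qed.

(** Being infinite is tested against natural numbers only: these, unlike the
reals, are fixed by every embedding. *)
Lemma hval_lt0_infinite f : 0 < f -> hval f < 0 -> forall n, n%:R < f.
Proof.
move=> f0 vf [|n] //; rewrite ltNge; apply/negP => /(hval_le f0).
by rewrite hval_nat oz_leNgt vf.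
Qed.

Lemma infinite_hval_lt0 f : (forall n, n%:R < f) -> hval f < 0.
Proof.
move=> inf; rewrite oz_ltNge; apply/negP => vf.
have f0 : f != 0 by rewrite gt_eqF ?(inf 0%N).
pose n := Num.Def.archi_bound `|f 0|.
have fn : f 0 < n%:R.
  exact: le_lt_trans (ler_norm _) (archi_boundP (normr_ge0 _)).
have v0 : hval (f - n%:R) = 0.
  apply: hval_unique => [|b]; rewrite hahnBE.
    by rewrite hahn_nat_coef0 subr_eq0 lt_eqF.
  have [->|b0] := eqVneq b 0; first by rewrite lexx.
  by rewrite hahn_nat_coef// subr0 => /(hvalP f0).2; exact: le_trans.
have := inf n; rewrite -subr_gt0 hahn_gt0 /hlead v0 hahnBE hahn_nat_coef0.
by rewrite subr_gt0 ltNge ltW.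
Qed.

End Infinite.

Lemma value_group_subgroup (R : realType) (G : orderedAbelianGroupType)
    (L : set (hahn R G)) :
  subfield L -> subgroup (value_group L).
Proof.
move=> sL; split.
  exists 1; first by split; [exact: subfield1|exact/eqP/oner_neq0].
  by rewrite -(expr0 1) hvalX ?oner_neq0// mulr0n.
move=> _ _ [f [Lf /eqP f0] <-] [g [Lg /eqP g0] <-].
exists (f / g).
  split; first exact: (subfieldM sL Lf (subfieldV sL Lg)).
  by apply/eqP; rewrite mulf_neq0 ?invr_eq0.
by rewrite (hval_leadM _ _).1 ?invr_eq0// hvalV.
Qed.

Section LE.
Variables (R : realType) (F : forall n, set (ran R n)) (M : realFieldType).
Variables (S : an_exp_structure R M) (iota : {rmorphism R -> M}) (x : M).

Lemma LE_closed_LE : LE_closed F S (LE F S iota x).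
Proof.
split.
- split=> [A [[[]]]//|y z hy hz A hA|y z hy hz A hA]; have [[sA _ _ _ _] _] := hA.
    exact: (subfieldB sA (hy A hA) (hz A hA)).
  exact: (subfieldM sA (hy A hA) (subfieldV sA (hz A hA))).
- move=> p p0 pS y py A hA; have [[_ cA _ _ _] _] := hA.
  by apply: (cA p) => // i; exact: pS.
- move=> n c Fc y yS A hA; have [[_ _ cA _ _] _] := hA.
  by apply: cA => // i; exact: yS.
- by move=> y yS A hA; have [[_ _ _ cA _] _] := hA; apply: cA; exact: yS.
- move=> y z yS y0 e A hA; have [[_ _ _ _ cA] _] := hA.
  by apply: (cA y) => //; exact: yS.
Qed.

Lemma LE_x : LE F S iota x x.
Proof. by move=> A [_]; apply; right. Qed.

Section Image.
Variables (G : orderedAbelianGroupType) (sigma : M -> hahn R G).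
Variable D : set M.
Hypotheses (mS : is_model S) (cD : LE_closed F S D).
Hypothesis emb : is_LF_embedding F S D sigma.
Local Notation L := (sigma @` D).

Let sD : subfield D. Proof. by case: cD. Qed.

Let sigmaB y z : D y -> D z -> sigma (y - z) = sigma y - sigma z.
Proof. by move=> Dy Dz; rewrite (embD emb) ?(embN emb)//; exact: subfieldN. Qed.

Let sigmaV y : D y -> sigma y^-1 = (sigma y)^-1.
Proof.
move=> Dy; have [->|y0] := eqVneq y 0; first by rewrite invr0 (emb0 emb) invr0.
have e : sigma y * sigma y^-1 = 1.
  by rewrite -(embM emb) ?mulfV ?(emb1 emb)//; exact: subfieldV.
have y0' : sigma y != 0.
  by apply/eqP => s0; move/eqP: e; rewrite s0 mul0r eq_sym oner_eq0.
by apply: (mulfI y0'); rewrite e mulfV.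
Qed.

Lemma embedding_nat n : sigma n%:R = n%:R.
Proof.
elim: n => [|n IH]; first exact: (emb0 emb).
by rewrite !mulrS (embD emb) ?(emb1 emb) ?IH//; [exact: subfield1|exact: subfield_nat].
Qed.

Let sigmaX y n : D y -> D (y ^+ n) /\ sigma (y ^+ n) = sigma y ^+ n.
Proof.
move=> Dy; elim: n => [|n [Dn IH]].
  by rewrite !expr0 (emb1 emb); split=> //; exact: subfield1.
by rewrite !exprS (embM emb)// IH; split=> //; exact: subfieldM.
Qed.

Lemma image_subfield : subfield L.
Proof.
split; first by exists 1; [exact: subfield1|exact: (emb1 emb)].
  move=> _ _ [y Dy <-] [z Dz <-]; exists (y - z); last exact: sigmaB.
  exact: subfieldB.
move=> _ _ [y Dy <-] [z Dz <-].
have DV : D z^-1 by exact: subfieldV.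
by exists (y / z); [exact: subfieldM|rewrite (embM emb)// sigmaV].
Qed.

Lemma image_fun_closed : fun_closed F (@ran_hahn R G) L.
Proof.
move=> n c Fc y yL.
have /choice[m mP] i : exists z, D z /\ sigma z = y i.
  by case: (yL i) => z; exists z.
exists (an_fun S c m).
  by case: cD => _ _ cF _ _; apply: cF => // i; case: (mP i).
rewrite (emb_fun emb Fc) => [|i]; last by case: (mP i).
by congr (ran_hahn c _); apply/funext => i; case: (mP i).
Qed.

Let sigma_le y z : D y -> D z -> (sigma y <= sigma z) = (y <= z).
Proof. by move=> Dy Dz; rewrite !leNgt (emb_lt emb). Qed.

(** The roots are found in the model, which has the intermediate value property,
and lie in the relatively algebraically closed subset [D]. *)
Lemma image_real_closed : real_closed_subfield L.
Proof.
move=> p pL _ _ [a Da <-] [b Db <-].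
have /choice[m mP] i : exists z, D z /\ sigma z = p`_i.
  by case: (pL i) => z; exists z.
pose q := \poly_(i < size p) m i.
have qD i : D q`_i.
  by rewrite coef_poly; case: ifP => _; [case: (mP i)|exact: subfield0].
have qE y : D y -> D q.[y] /\ sigma q.[y] = p.[sigma y].
  move=> Dy; rewrite horner_poly horner_coef.
  elim/big_ind2: _ => [|u u' v v' [Du <-] [Dv <-]|i _].
  - by split; [exact: subfield0|exact: (emb0 emb)].
  - by split; [exact: subfieldD|exact: (embD emb)].
  have [Dm em] := mP i; have [DX eX] := sigmaX i Dy.
  by rewrite (embM emb)// em eX; split=> //; exact: subfieldM.
have [Dqa ea] := qE a Da; have [Dqb eb] := qE b Db.
rewrite sigma_le// -ea -eb -(emb0 emb) !sigma_le//; try exact: subfield0.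
move=> ab pab; have [q0|q0] := eqVneq q 0.
  exists (sigma a); last by rewrite rootE -ea q0 horner0 (emb0 emb).
  by rewrite lexx sigma_le.
have [t /andP[at_ tb] qt] := model_ivt mS ab pab.
have Dt : D t by case: cD => _ cl _ _ _; exact: (cl q).
exists (sigma t); last by rewrite rootE -(qE t Dt).2 (eqP qt) (emb0 emb).
by split; [exists t|rewrite !sigma_le// at_].
Qed.

Lemma model_expMn y n : an_exp S (y *+ n.+1) = an_exp S y ^+ n.+1.
Proof.
elim: n => [|n IH]; first by rewrite mulr1n expr1.
by rewrite mulrS (model_expD mS) IH -exprS.
Qed.

(** The element [g] is [- v (log f)].  It is positive because [log f] is
infinite, and small because [f = exp (log f / k) ^ k > (log f / k) ^ k]. *)
Lemma image_log f : is_substructure F S iota -> L f -> 0 < f -> hval f < 0 ->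
  exists2 g : G, 0 < g & forall k, hval f < - (g *+ k).
Proof.
move=> [iota_lt _ iota_exp] [m Dm <-] m_gt0 vm.
have Dn n : D n%:R by exact: subfield_nat.
have m_inf n : n%:R < m.
  by rewrite -(emb_lt emb)// embedding_nat; exact: hval_lt0_infinite.
have [l lm] := model_log mS (m_inf 0%N).
have Dl : D l by case: cD => _ _ _ _ /(_ m l); apply => //; exact: (m_inf 0%N).
have l_inf n : n%:R < l.
  rewrite ltNge; apply/negP => ln.
  pose N := Num.Def.archi_bound (expR (n%:R : R)).
  have : an_exp S n%:R < N%:R.
    rewrite -(rmorph_nat iota n) -iota_exp -(rmorph_nat iota N) iota_lt.
    exact: archi_boundP (expR_ge0 _).
  apply/negP; rewrite -leNgt (le_trans (ltW (m_inf N)))// -lm.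
  by move: ln; rewrite le_eqVlt => /orP[/eqP->//|/(model_exp_lt mS)/ltW].
have vl : hval (sigma l) < 0.
  by apply: infinite_hval_lt0 => n; rewrite -embedding_nat (emb_lt emb).
exists (- hval (sigma l)); first by rewrite oz_oppr_gt0.
(* k.+1 instead of k makes the inequality strict *)
move=> k; rewrite mulNrn opprK.
pose u := l / k.+1%:R.
have ul : u * k.+1%:R = l by rewrite divfK// pnatr_eq0.
have Du : D u by apply: subfieldM => //; exact: subfieldV.
have u_gt0 : 0 < u by rewrite divr_gt0// (l_inf 0%N).
have um : u ^+ k.+1 < m.
  have -> : m = an_exp S u ^+ k.+1.
    by rewrite -model_expMn -mulr_natr ul.
  by rewrite ltrXn2r// ?(ltW u_gt0)// (model_lt_exp mS).
have [DX eX] := sigmaX k.+1 Du.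
have su0 : sigma u != 0.
  by rewrite gt_eqF// -(emb0 emb) (emb_lt emb)//; exact: subfield0.
have vu : hval (sigma u) = hval (sigma l).
  have e : sigma l = sigma u * k.+1%:R.
    by rewrite -embedding_nat -(embM emb)// ul.
  by rewrite e (hval_leadM _ _).1 ?hval_nat ?addr0// pnatr_eq0.
have : hval (sigma m) <= hval (sigma l) *+ k.+1.
  rewrite -vu -hvalX// -eX; apply: hval_le; last by rewrite sigma_le// ltW.
  by rewrite -(emb0 emb) (emb_lt emb) ?exprn_gt0//; exact: subfield0.
move/le_lt_trans; apply; rewrite mulrS -[ltRHS]add0r.
by apply: oz_ltleD.
Qed.

Lemma image_small e : is_substructure F S iota -> value_group L e -> e != 0 ->
  exists2 g : G, 0 < g & ~ convex_span g e.
Proof.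
move=> sub [f [Lf /eqP f0] <-].
wlog f_gt0 : f Lf f0 / 0 < f.
  move=> H; have [f_gt0|] := ltrP 0 f; first exact: H.
  rewrite le_eqVlt (negPf f0)/= -oppr_gt0 -hvalN; apply: H.
    exact: subfieldN image_subfield _ Lf.
  by rewrite oppr_eq0.
move=> v0; wlog vf : f Lf f0 f_gt0 v0 / hval f < 0.
  move=> H; case/orP: (oz_le_total 0 (hval f)) => vf; last first.
    by apply: (H f) => //; rewrite lt_neqAle v0.
  have vV := hvalV f0.
  have [|||||g g0 gP] := H f^-1.
  - exact: subfieldV image_subfield _ Lf.
  - by rewrite invr_eq0.
  - by rewrite invr_gt0.
  - by rewrite vV oppr_eq0.
  - by rewrite vV lt_neqAle oppr_eq0 v0 -[leRHS]oppr0 oz_oppr_le.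
  exists g => // Cg; apply: gP; rewrite vV.
  exact: (subgroupN (convex_span_pure (ltW g0)).1).
have [g g0 gP] := image_log sub Lf f_gt0 vf.
by exists g => // -[k /andP[]]; rewrite oz_leNgt gP.
Qed.

End Image.
End LE.

(** * Series of finite rank *)

Section FiniteRank.
Variables (R : realType) (G : orderedAbelianGroupType) (V : set G).
Implicit Types (f g : hahn R G).

(** The directed union of the fields R((D)), for D the pure hull of a finite
subset of V. *)
Definition finite_rank_series : set (hahn R G) :=
  [set f | exists2 s : seq G, [set` s] `<=` V & hahn_on (pure_hull [set` s]) f].

Lemma finite_rank_family (T : finType) (y : T -> hahn R G) :
  (forall i, finite_rank_series (y i)) ->
  exists2 s : seq G, [set` s] `<=` V &
    forall i, hahn_on (pure_hull [set` s]) (y i).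
Proof.
move=> yP.
have /choice[t tP] i : exists s : seq G,
    [set` s] `<=` V /\ hahn_on (pure_hull [set` s]) (y i).
  by case: (yP i) => s sV ys; exists s.
exists (flatten [seq t i | i <- enum T]).
  by move=> a /= /flatten_mapP[i _]; exact: (tP i).1.
move=> i; apply: subset_trans (tP i).2 _; apply: pure_hullS => a /= ta.
by apply/flatten_mapP; exists i; rewrite ?mem_enum.
Qed.

Lemma finite_rank_subfield : subfield finite_rank_series.
Proof.
split.
- exists [::] => [a //|]; apply: hahn_on1; exact: (pure_hull_pure _).1.1.
- move=> f g fP gP.
  have [|s sV sP] := @finite_rank_family bool (fun b => if b then f else g).
    by case.
  by exists s => //; apply: hahn_onB; [exact: (sP true)|exact: (sP false)].
move=> f g fP gP.
have [|s sV sP] := @finite_rank_family bool (fun b => if b then f else g).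
  by case.
have sH := (pure_hull_pure [set` s]).1.
by exists s => //; apply: (hahn_onM sH (sP true)); apply: (hahn_onV sH (sP false)).
Qed.

Lemma finite_rank_fun_closed (F : forall n, set (ran R n)) :
  fun_closed F (@ran_hahn R G) finite_rank_series.
Proof.
move=> n c _ y /finite_rank_family[s sV sP]; exists s => //.
by apply: ran_hahn_on => //; exact: (pure_hull_pure _).1.
Qed.

Lemma finite_rank_relatively_closed (p : {poly hahn R G}) f : p != 0 ->
  (forall i, finite_rank_series p`_i) -> root p f -> finite_rank_series f.
Proof.
move=> p0 pP pf.
have [s sV sP] := @finite_rank_family 'I_(size p) (fun i => p`_i) (fun i => pP i).
exists s => //; apply: (hahn_on_relatively_closed (pure_hull_pure _) p0 _ pf) => i.
have [ip|ip] := ltnP i (size p); first exact: (sP (Ordinal ip)).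
by rewrite nth_default//; exact: hahn_on0.
Qed.

Lemma finite_rank_bounded_away0 : subgroup V -> (exists g : G, 0 < g) ->
  (forall e, V e -> e != 0 -> exists2 g, 0 < g & ~ convex_span g e) ->
  forall f, finite_rank_series f -> bounded_away0 (nonzeros f `\ 0).
Proof.
move=> sV0 pos small f [s sV sf].
have [||g g0 gP] := @pure_hull_avoids _ (pure_hull V) (pure_hull_pure V) pos _ s.
- move=> e /(pure_hull_subgroup sV0)[n Ve] e0.
  have ne0 : e *+ n.+1 != 0 by apply: contraNneq e0 => /oz_mulrn_eq0 ->.
  have [g g0 ng] := small _ Ve ne0; exists g => // Ce; apply: ng.
  exact: (subgroupMn _ (convex_span_pure (ltW g0)).1).
- by apply: subset_trans sV _; exact: sub_pure_hull.
exists (- g), g; split=> //; first by rewrite -oz_oppr_gt0 opprK.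
move=> a [fa a0]; apply/negP => /andP[/ltW ga /ltW ag]; apply: a0.
by apply: gP; split; [exact: sf|exists 1%N; rewrite mulr1n ga].
Qed.

End FiniteRank.

Arguments finite_rank_series {R G} V.


Theorem corollary5p3 (R : realType) (F : forall n : nat, set (ran R n))
  (F_deriv : deriv_closed F)
  (F_exp : has_restricted_exp F)
  (F_log : has_restricted_log F)
  (M : realFieldType) (S : an_exp_structure R M)
  (M_model : is_model S)
  (M_nonarch : ~ Num.archimedean_axiom M)
  (iota : {rmorphism R -> M})
  (R_sub_M : is_substructure F S iota)
  (x : M)
  (x_gt0 : 0 < x)
  (x_infinite : forall r : R, iota r < x)
  (G : orderedAbelianGroupType)
  (sigma : M -> hahn R G)
  (sigma_emb : is_LF_embedding F S (LE F S iota x) sigma)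
  (L : set (hahn R G))
  (L_def : L = sigma @` LE F S iota x)
  (L_cs : is_cross_section L (@canonical_cross_section R G))
  (L_eq : L = rF_closure F (@canonical_cross_section R G @` value_group L)) :
  forall f : hahn R G, L f -> bounded_away0 (nonzeros f `\ 0).
Proof.
have cD := LE_closed_LE F S iota x.
have sL : subfield L by rewrite L_def; exact: (image_subfield cD sigma_emb).
pose V := value_group L; pose N := L `&` finite_rank_series V.
have sN : subfield N.
  have sP := finite_rank_subfield R V; split.
  - by split; exact: subfield1.
  - by move=> f g [Lf Pf] [Lg Pg]; split; apply: subfieldB.
  by move=> f g [Lf Pf] [Lg Pg]; split; apply: subfieldM => //; apply: subfieldV.
have rcN : real_closed_subfield N.
  have rcL : real_closed_subfield L.
    by rewrite L_def; exact: (image_real_closed M_model cD sigma_emb).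
  move=> p pN a b [La Pa] [Lb Pb] ab pab.
  have [p0|p0] := eqVneq p 0.
    by exists a; [rewrite lexx|rewrite p0 root0].
  have [|y [Ly yab] py] := rcL p _ a b La Lb ab pab; first by move=> i; case: (pN i).
  exists y => //; split=> //; split=> //.
  by apply: (finite_rank_relatively_closed p0 _ py) => i; case: (pN i).
have LN : L `<=` N.
  rewrite {1}L_eq; apply: smallest_sub.
    split=> //; last exact: real_closed_henselian.
    move=> n c Fc y yN; split.
      rewrite L_def; apply: (image_fun_closed cD sigma_emb) => // i.
      by rewrite -L_def; case: (yN i).
    by apply: finite_rank_fun_closed => // i; case: (yN i).
  move=> f gf; split; first by rewrite L_eq; exact: sub_gen_smallest.
  case: gf => [[r _ <-]|[a Va <-]].
    by exists [::] => [//|]; apply: hahn_on_mono; exact: (pure_hull_pure _).1.1.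
  exists [:: a] => [b|]; first by rewrite /= inE => /eqP ->.
  by apply: hahn_on_mono; apply: sub_pure_hull; rewrite /= inE.
move=> f /LN[_]; apply: finite_rank_bounded_away0.
- exact: value_group_subgroup.
- have Dx : LE F S iota x x by exact: LE_x.
  have sx : hval (sigma x) < 0.
    apply: infinite_hval_lt0 => n; rewrite -(embedding_nat cD sigma_emb).
    rewrite (emb_lt sigma_emb)//; first by rewrite -(rmorph_nat iota).
    by apply: subfield_nat; case: cD.
  by exists (- hval (sigma x)); rewrite oz_oppr_gt0.
- rewrite /V L_def => e; exact: (image_small M_model cD sigma_emb R_sub_M).
Qed.
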